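(* Let $\mathcal{A}$ be a non-acyclic rank three skew-symmetric cluster algebra of geometric type, and let $\mathcal{U}$ be its upper cluster algebra. Then $\mathcal{A}\neq\mathcal{U}$.
   Context: Seeds and mutation. Let $m\ge n\ge 1$ be integers, $\mathcal{F}=\mathbb{Q}(x_1,\dots,x_m)$, $[a]_+=\max(0,a)$. A seed of rank $n$ is a pair $\Sigma=(\tilde{\mathbf{x}},\tilde{B})$ where $\tilde{\mathbf{x}}=\{x_1,\dots,x_m\}$ is an $m$-tuple of elements of $\mathcal{F}$ forming a free generating set, and $\tilde{B}=(b_{ij})$ is an $m\times n$ integer matrix; its top $n\times n$ submatrix $B$ is called the principal part (exchange matrix). Here the seeds are skew-symmetric, i.e. $B$ is skew-symmetric (this is preserved by mutation), and $n=3$. For $1\le k\le n$, the mutation $\mu_k(\tilde{\mathbf{x}},\tilde{B})=(\tilde{\mathbf{x}}',\tilde{B}')$ is given by $x_i'=x_i$ for $i\ne k$, $x_k'=x_k^{-1}\big(\prod_{i=1}^m x_i^{[b_{ik}]_+}+\prod_{i=1}^m x_i^{[-b_{ik}]_+}\big)$, and $b_{ij}'=-b_{ij}$ if $i=k$ or $j=k$, $b'_{ij}=b_{ij}+\frac{|b_{ik}|b_{kj}+b_{ik}|b_{kj}|}{2}$ otherwise. Two seeds are mutation-equivalent if related by a sequence of mutations. Cluster algebras. Put $\mathbb{ZP}=\mathbb{Z}[x_{n+1}^{\pm1},\dots,x_m^{\pm1}]$ (the variables $x_{n+1},\dots,x_m$ are never mutated). The cluster of a seed is $\{x_1,\dots,x_n\}$.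 Given an initial seed, the cluster algebra $\mathcal{A}$ of geometric type is the subring of $\mathcal{F}$ generated over $\mathbb{ZP}$ by all clusters of all seeds mutation-equivalent to the initial one; these are the seeds (and clusters) of $\mathcal{A}$. The upper cluster algebra is $\mathcal{U}=\bigcap_{\mathbf{x}}\mathbb{ZP}[x_1^{\pm1},\dots,x_n^{\pm1}]$, where $\mathbf{x}=\{x_1,\dots,x_n\}$ runs over all clusters of $\mathcal{A}$. A seed is acyclic if the digraph on vertices $1,\dots,n$ with an arrow $i\to j$ whenever $b_{ij}>0$ has no oriented cycles. $\mathcal{A}$ is acyclic if it has an acyclic seed, and non-acyclic otherwise. *)

(* Defs.v *)
From HB Require Import structures.
From mathcomp Require Import all_boot all_order all_algebra.
From mathcomp Require Import mpoly.
Set Implicit Arguments.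
Unset Strict Implicit.
Unset Printing Implicit Defensive.
Import Order.TTheory GRing.Theory Num.Theory.
Local Open Scope ring_scope.

(* The field Q(x_1, ..., x_m). *)
Definition ratfun (m : nat) : fieldType := {fraction {mpoly rat[m]}}.

Definition ratfunC (m : nat) : rat -> ratfun m :=
  @tofrac {mpoly rat[m]} \o @mpolyC m rat.

Definition ratfun_eval (m : nat) (x : {ffun 'I_m -> ratfun m})
    (P : {mpoly rat[m]}) : ratfun m :=
  mmap (@ratfunC m) x P.

(* x is algebraically independent over Q, and Q(x) is the whole field. *)
Definition free_generating (m : nat) (x : {ffun 'I_m -> ratfun m}) : Prop :=
  (forall P : {mpoly rat[m]}, ratfun_eval x P = 0 -> P = 0) /\
  (forall f : ratfun m, exists P Q : {mpoly rat[m]},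
     ratfun_eval x Q != 0 /\ f = ratfun_eval x P / ratfun_eval x Q).

(* The data (x~, B~) of a seed; the axioms of a seed are in [is_seed]. *)
Record seed (F : fieldType) (m n : nat) := Seed {
  seed_var : {ffun 'I_m -> F};
  seed_mx : 'M[int]_(m, n)
}.

Definition principal_part (m n : nat) (le_nm : (n <= m)%N)
    (B : 'M[int]_(m, n)) : 'M[int]_n :=
  rowsub (widen_ord le_nm) B.

Definition skew_symmetric (n : nat) (B : 'M[int]_n) : Prop := B^T = - B.

Definition is_seed (m n : nat) (le_nm : (n <= m)%N)
    (s : seed (ratfun m) m n) : Prop :=
  free_generating (seed_var s) /\
  skew_symmetric (principal_part le_nm (seed_mx s)).

Definition pos_part (a : int) : int := Num.max 0 a.

(* The division by 2 is exact: the numerator is 0 or +-2 |b_ik b_kj|. *)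
Definition mutate_mx (m n : nat) (le_nm : (n <= m)%N)
    (B : 'M[int]_(m, n)) (k : 'I_n) : 'M[int]_(m, n) :=
  let k' := widen_ord le_nm k in
  \matrix_(i, j)
    if (i == k') || (j == k) then - B i j
    else B i j + ((`|B i k| * B k' j + B i k * `|B k' j|) %/ 2)%Z.

Definition mutate_var (F : fieldType) (m n : nat) (le_nm : (n <= m)%N)
    (s : seed F m n) (k : 'I_n) : {ffun 'I_m -> F} :=
  let k' := widen_ord le_nm k in
  let x := seed_var s in
  let B := seed_mx s in
  [ffun i => if i == k'
             then (x k')^-1 * (\prod_(j < m) x j ^ pos_part (B j k)
                               + \prod_(j < m) x j ^ pos_part (- B j k))
             else x i].

Definition mutate (F : fieldType) (m n : nat) (le_nm : (n <= m)%N)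
    (s : seed F m n) (k : 'I_n) : seed F m n :=
  Seed (mutate_var le_nm s k) (mutate_mx le_nm (seed_mx s) k).

Definition mutation_equivalent (F : fieldType) (m n : nat)
    (le_nm : (n <= m)%N) (s t : seed F m n) : Prop :=
  exists ks : seq 'I_n, t = foldl (mutate le_nm) s ks.

Inductive generated_subring (R : nzRingType) (G : R -> Prop) : R -> Prop :=
| gen_in (a : R) : G a -> generated_subring G a
| gen_one : generated_subring G 1
| gen_sub (a b : R) : generated_subring G a -> generated_subring G b ->
    generated_subring G (a - b)
| gen_mul (a b : R) : generated_subring G a -> generated_subring G b ->
    generated_subring G (a * b).

Definition in_cluster (F : fieldType) (m n : nat) (le_nm : (n <= m)%N)
    (s : seed F m n) (f : F) : Prop :=
  exists k : 'I_n, f = seed_var s (widen_ord le_nm k).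

(* ZP = Z[x_{n+1}^{+-1}, ..., x_m^{+-1}]; with 0-based indices the frozen
   variables are those of index i >= n. *)
Definition ground_ring (F : fieldType) (m n : nat) (s : seed F m n) :
    F -> Prop :=
  generated_subring (fun f => exists2 i : 'I_m, (n <= i)%N &
    f = seed_var s i \/ f = (seed_var s i)^-1).

(* The frozen variables are never mutated, so ZP is read off the initial
   seed s0; s is the seed whose cluster is inverted. *)
Definition laurent_ring (F : fieldType) (m n : nat) (le_nm : (n <= m)%N)
    (s0 s : seed F m n) : F -> Prop :=
  generated_subring (fun f =>
    ground_ring s0 f \/ in_cluster le_nm s f \/ in_cluster le_nm s f^-1).

Definition cluster_algebra (F : fieldType) (m n : nat) (le_nm : (n <= m)%N)
    (s0 : seed F m n) : F -> Prop :=
  generated_subring (fun f =>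
    ground_ring s0 f \/
    exists2 s, mutation_equivalent le_nm s0 s & in_cluster le_nm s f).

Definition upper_cluster_algebra (F : fieldType) (m n : nat)
    (le_nm : (n <= m)%N) (s0 : seed F m n) (f : F) : Prop :=
  forall s, mutation_equivalent le_nm s0 s -> laurent_ring le_nm s0 s f.

(* [cycle] holds on the empty sequence, which is therefore excluded. *)
Definition acyclic_mx (n : nat) (B : 'M[int]_n) : Prop :=
  forall c : seq 'I_n, c != [::] -> ~~ cycle (fun i j => 0 < B i j) c.

Definition acyclic_cluster_algebra (F : fieldType) (m n : nat)
    (le_nm : (n <= m)%N) (s0 : seed F m n) : Prop :=
  exists2 s, mutation_equivalent le_nm s0 s &
    acyclic_mx (principal_part le_nm (seed_mx s)).

(* Main.v *)
Require Import Defs.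
From mathcomp Require Import all_boot all_order all_algebra.
From mathcomp Require Import mpoly.
From mathcomp Require Import ring lra zify.
Set Implicit Arguments.
Unset Strict Implicit.
Unset Printing Implicit Defensive.
Import Order.TTheory GRing.Theory Num.Theory.
Local Open Scope ring_scope.

(** Non-acyclicity says that the quiver of every seed is an oriented 3-cycle,
    with multiplicities, say, [d1], [d2], [d3], where [dl] counts the arrows
    between the two vertices other than [l]. Giving [x_l] the degree [dl] and
    the frozen variables the degree 0 makes every exchange relation homogeneous,
    and mutation at [l] replaces [dl] by the product of the two other
    multiplicities minus [dl] ([opposite_mutate],
    [cyclic_homogeneous_exchange]). Hence the cluster algebra is graded,
    cluster variables have positive degree, and a product of cluster variables
    has at least the degree of each factor.

    Choose a seed, the root, where [d1 + d2 + d3] is minimal, and order it as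
    [d1 <= d2 <= d3]; then [d3 <= d1 d2 - d3] ([class_root]). Away from the
    root the degrees of new cluster variables keep growing
    ([reduced_growth]), so that all cluster variables other than [x1], [x2],
    [x3] and the mutation [x3'] of [x3] have degree at least
    [D = d1 d3 - d2], which is the degree of [x2']. With
    [x2 x2' = p x1^d3 + q x3^d1] and [x3 x3' = p' x1^d2 + q' x2^d1], where [p],
    [q], [p'], [q'] are frozen monomials, consider
      [f = (p p' x1^d3 + p q' x1^(d3-d2) x2^d1 + q p' x3^d1) / (x2 x3)
         = (x2' x3' - q q' (x2 x3)^(d1-1)) / x1^d2].
    Its degree is [D - d3 < D]. If [f] were in the cluster algebra it would
    be a polynomial in [x1], [x2], [x3], [x3'] and the frozen variables and
    their inverses, hence have no [x2] in its denominator, but the first term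
    has one ([cluster_algebra_regular], [witness]).

    On the other hand [f] is in the upper cluster algebra. Its two expressions
    show that, for each [l], it is Laurent in the variables other than [x_l]
    and polynomial in [x_l] and [x_l']. This property is inherited by the
    adjacent seeds ([upper_bound_mutate]). Indeed, for [k] and [l] distinct,
    the ring [T] of the functions of this kind for [l] in the seed mutated at
    [k] contains the old [x_l'] (the rank two computation [rank2_y0]), so it
    contains [x_k^M f] and [x_l^N f] for large [M] and [N]; as [x_k x_k'] is a
    unit modulo [x_l], the powers [x_k^M] and [x_l^N] are comaximal in [T], and
    [f] is in [T]. The same argument, applied with degrees to the cluster
    variables, is the Laurent phenomenon: every cluster variable is a
    homogeneous Laurent polynomial in the root cluster. *)

(** * Graded subrings of a field *)

(** Only homogeneous elements are generated, each together with a degree; the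
    ambient field carries no grading, so the degree is data. *)
Inductive graded_subring (F : fieldType) (G : int -> F -> Prop) :
    int -> F -> Prop :=
| graded_in d a : G d a -> graded_subring G d a
| graded_one : graded_subring G 0 1
| graded_sub d a b : graded_subring G d a -> graded_subring G d b ->
    graded_subring G d (a - b)
| graded_mul d e a b : graded_subring G d a -> graded_subring G e b ->
    graded_subring G (d + e) (a * b).

Section GradedSubring.

Variables (F : fieldType) (G : int -> F -> Prop).
Local Notation T := (graded_subring G).

Lemma graded0 d a : T d a -> T d 0.
Proof. by move=> Ta; rewrite -(subrr a); apply: graded_sub. Qed.

Lemma gradedN d a : T d a -> T d (- a).
Proof.
by move=> Ta; rewrite -sub0r; apply: graded_sub => //; apply: graded0 Ta.
Qed.

Lemma gradedD d a b : T d a -> T d b -> T d (a + b).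
Proof.
by move=> Ta Tb; rewrite -[b]opprK; apply: graded_sub => //; apply: gradedN.
Qed.

Lemma gradedM c d e a b : T d a -> T e b -> c = d + e -> T c (a * b).
Proof. by move=> Ta Tb ->; apply: graded_mul. Qed.

Lemma gradedX d a (n : nat) : T d a -> T (d *+ n) (a ^+ n).
Proof.
move=> Ta; elim: n => [|n IHn]; first exact: graded_one.
by rewrite exprS mulrS; apply: graded_mul.
Qed.

Definition graded_unit d a := [/\ a != 0, T d a & T (- d) a^-1].

Lemma graded_unit1 : graded_unit 0 1.
Proof. by split; rewrite ?oner_neq0 ?oppr0 ?invr1 //; apply: graded_one. Qed.

Lemma graded_unitM d e a b :
  graded_unit d a -> graded_unit e b -> graded_unit (d + e) (a * b).
Proof.
case=> a0 Ta Tai [b0 Tb Tbi]; split; first by rewrite mulf_neq0.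
  exact: graded_mul.
by rewrite invfM opprD; apply: graded_mul.
Qed.

Lemma graded_unitV d a : graded_unit d a -> graded_unit (- d) a^-1.
Proof. by case=> a0 Ta Tai; split; rewrite ?invr_eq0 ?opprK ?invrK. Qed.

Lemma graded_unitX d a (n : nat) :
  graded_unit d a -> graded_unit (d *+ n) (a ^+ n).
Proof.
move=> Ua; elim: n => [|n IHn]; first exact: graded_unit1.
by rewrite exprS mulrS; apply: graded_unitM.
Qed.

Lemma graded_unitXz d a (z : int) :
  graded_unit d a -> graded_unit (d * z) (a ^ z).
Proof.
move=> Ua; case: z => n; first by rewrite -mulrzz; apply: graded_unitX.
by rewrite NegzE mulrN -mulrzz; apply/graded_unitV/graded_unitX.
Qed.

Lemma gradedXz d a (z : int) : 0 <= z -> T d a -> T (d * z) (a ^ z).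
Proof. by case: z => // n _ Ta; rewrite -mulrzz; apply: gradedX. Qed.

Lemma graded_unit_prod (I : finType) (P : pred I) (x : I -> F)
    (g e : I -> int) :
  (forall i, P i -> graded_unit (g i) (x i)) ->
  graded_unit (\sum_(i | P i) g i * e i) (\prod_(i | P i) x i ^ e i).
Proof.
move=> Ux; apply: (big_rec2 (fun f d => graded_unit d f)).
  exact: graded_unit1.
by move=> i d f Pi Uf; apply: graded_unitM => //; apply/graded_unitXz/Ux.
Qed.

Lemma graded_prod (I : finType) (x : I -> F) (g e : I -> int) :
  (forall i, 0 <= e i) -> (forall i, T (g i) (x i)) ->
  T (\sum_i g i * e i) (\prod_i x i ^ e i).
Proof.
move=> e_ge0 Tx; apply: (big_rec2 (fun f d => T d f)); first exact: graded_one.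
by move=> i d f _ Tf; apply: graded_mul => //; apply: gradedXz.
Qed.

(** Finitely many generators occur in a given element, so a common power of
    [z] clears its denominators as soon as it clears those of generators. *)
Lemma graded_subring_denominator (H : int -> F -> Prop) e z :
  T e z ->
  (forall d a, H d a -> exists N : nat, T (d + e *+ N) (z ^+ N * a)) ->
  forall d a, graded_subring H d a ->
    exists N : nat, T (d + e *+ N) (z ^+ N * a).
Proof.
move=> Tz TH d a; elim=> {d a} [d a /TH //| |d a b _ [M Ta] _ [N Tb]|].
- by exists 0%N; rewrite mulr1 add0r; apply: graded_one.
- exists (M + N)%N; rewrite mulrBr exprD; apply: graded_sub.
    rewrite mulrAC mulrC; apply: gradedM (gradedX N Tz) Ta _.
    by rewrite mulrnDr; ring.
  rewrite -mulrA; apply: gradedM (gradedX M Tz) Tb _.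
  by rewrite mulrnDr; ring.
- move=> d d' a b _ [M Ta] _ [N Tb]; exists (M + N)%N.
  rewrite exprD mulrACA; apply: gradedM Ta Tb _.
  by rewrite mulrnDr; ring.
Qed.

(** Two comaximal elements detect membership: from [1 = p * y + q * z] an
    element [f] is recovered from [y * f] and [z * f], and induction on the
    exponents handles powers. *)
Lemma graded_comaximal c e y z p q :
  T c y -> T e z -> T (- c) p -> T (- e) q -> p * y + q * z = 1 ->
  forall (M N : nat) d f, T (d + c *+ M) (y ^+ M * f) ->
    T (d + e *+ N) (z ^+ N * f) -> T d f.
Proof.
move=> Ty Tz Tp Tq pq1 M N.
elim: {M N}(M + N)%N {-2}M {-2}N (leqnn (M + N)) => [|s IHs] [|M] [|N] //=.
- by move=> _ d f; rewrite expr0 mul1r mulr0n addr0.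
- by move=> _ d f; rewrite expr0 mul1r mulr0n addr0.
- by move=> _ d f; rewrite expr0 mul1r mulr0n addr0.
- by move=> _ d f _; rewrite expr0 mul1r mulr0n addr0.
move=> le_s d f Tyf Tzf.
have Tyf1 : T (d + c) (y * f).
  apply: (IHs M N.+1); first by rewrite -ltnS -addSn.
    by rewrite mulrA -exprSr -addrA -mulrS.
  rewrite mulrCA; apply: gradedM Ty Tzf _.
  by ring.
have Tzf1 : T (d + e) (z * f).
  apply: (IHs M.+1 N); first by rewrite -ltnS -addnS.
    rewrite mulrCA; apply: gradedM Tz Tyf _.
    by ring.
  by rewrite mulrA -exprSr -addrA -mulrS.
rewrite -[f]mul1r -pq1 mulrDl -!mulrA; apply: gradedD.
  by apply: gradedM Tp Tyf1 _; ring.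
by apply: gradedM Tq Tzf1 _; ring.
Qed.

Lemma graded_pow_expansion d e u v z (a : nat) :
  T (d - e) u -> T d v -> T e z ->
  exists2 g, T (d *+ a.+1 - e) g & (u * z + v) ^+ a.+1 = v ^+ a.+1 + z * g.
Proof.
move=> Tu Tv Tz; elim: a => [|a [g Tg IHa]].
  by exists u => //; ring.
exists (u * v ^+ a.+1 + u * z * g + v * g); last first.
  by rewrite exprS IHa (exprS v a.+1); move: (v ^+ a.+1) => va; ring.
have Tuz : T d (u * z) by apply: gradedM Tu Tz _; ring.
apply: gradedD; [apply: gradedD|].
- apply: gradedM Tu (gradedX a.+1 Tv) _. rewrite (mulrS d a.+1); ring.
- by apply: gradedM Tuz Tg _; rewrite (mulrS d a.+1); ring.
- by apply: gradedM Tv Tg _; rewrite (mulrS d a.+1); ring.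
Qed.

(** * Three consecutive exchanges in rank two *)

(** The sequence [y0], ..., [y4] runs through the clusters [{y0, y1}],
    [{y1, y2}], [{y2, y3}] and [{y3, y4}] of a rank two mutation class with
    coefficients; the seed with cluster [{y1, y2}] is the starting one. *)
Section RankTwo.

Variables (a : nat) (y0 y1 y2 y3 y4 u v u1 v1 u2 v2 : F).
Variables (e0 e1 e2 e3 e4 du dv du1 dv1 du2 : int).
Hypotheses (Ty2 : T e2 y2) (y2_neq0 : y2 != 0).
Hypotheses (Uy3 : graded_unit e3 y3) (Ty4 : T e4 y4).
Hypotheses (Uu : graded_unit du u) (Uv : graded_unit dv v).
Hypotheses (Uu1 : graded_unit du1 u1) (Uv1 : graded_unit dv1 v1).
Hypothesis Uu2 : graded_unit du2 u2.
Hypothesis y13 : y1 * y3 = u1 * y2 ^+ a.+1 + v1.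
Hypothesis y20 : y2 * y0 = u * y1 ^+ a.+1 + v.
Hypothesis y24 : y2 * y4 = u2 * y3 ^+ a.+1 + v2.
Hypothesis coef_eq : v2 * v = u2 * u * v1 ^+ a.+1.
Hypotheses (du1E : du1 + e2 *+ a.+1 = e1 + e3) (dv1E : dv1 = e1 + e3).
Hypotheses (duE : du + e1 *+ a.+1 = e2 + e0) (dvE : dv = e2 + e0).
Hypothesis du2E : du2 + e3 *+ a.+1 = e2 + e4.

Lemma rank2_y1 : T e1 y1.
Proof.
case: Uy3 => y30 Ty3 Ty3i; case: Uu1 => _ Tu1 _; case: Uv1 => _ Tv1 _.
have ->: y1 = (u1 * y2 ^+ a.+1 + v1) * y3^-1 by rewrite -y13 mulfK.
apply: (gradedM (d := e1 + e3)) Ty3i _; last by ring.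
apply: gradedD; last by rewrite -dv1E.
by apply: gradedM Tu1 (gradedX _ Ty2) _.
Qed.

(** Modulo [y2] the element [y1] equals [v1 / y3], so that the numerators of
    [y0] and of [y4] agree there up to a unit: this is [coef_eq]. Hence [y0]
    is a unit multiple of [y4] plus a regular term. *)
Lemma rank2_y0 : T e0 y0.
Proof.
case: Uy3 => y30 Ty3 Ty3i; case: (Uu1) => _ Tu1 _; case: (Uv1) => _ Tv1 _.
case: (Uu) => u0 Tu _; case: (Uu2) => u20 _ Tu2i; case: (Uv) => _ Tv _.
have Tw : T (e1 + e3 - e2) (u1 * y2 ^+ a).
  apply: gradedM Tu1 (gradedX _ Ty2) _.
  by rewrite -du1E mulrS; ring.
rewrite dv1E in Tv1.
have [g Tg gE] := graded_pow_expansion a Tw Tv1 Ty2.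
have y1E : (y1 * y3) ^+ a.+1 = v1 ^+ a.+1 + y2 * g.
  by rewrite -gE y13; congr (_ ^+ _); rewrite exprSr; ring.
have y0E : y0 = u * g * (y3 ^+ a.+1)^-1 + v * u2^-1 * y4 * (y3 ^+ a.+1)^-1.
  have y3a0 : y3 ^+ a.+1 != 0 by rewrite expf_neq0.
  apply: (mulfI y2_neq0); apply: (mulIf y3a0); apply: (mulIf u20).
  rewrite y20 !mulrDr !mulrDl.
  have ->: y2 * (u * g / y3 ^+ a.+1) * y3 ^+ a.+1 * u2 = y2 * u * g * u2.
    by move: (y3 ^+ _) y3a0 => Y Y0; field.
  have ->: y2 * (v / u2 * y4 / y3 ^+ a.+1) * y3 ^+ a.+1 * u2 = v * (y2 * y4).
    by move: (y3 ^+ _) y3a0 => Y Y0; field; rewrite Y0 u20.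
  have ->: u * y1 ^+ a.+1 * y3 ^+ a.+1 * u2 = u2 * u * (y1 * y3) ^+ a.+1.
    by rewrite exprMn; ring.
  by rewrite y1E y24 mulrDr -coef_eq; ring.
have Ty3ai : T (- (e3 *+ a.+1)) (y3 ^+ a.+1)^-1.
  by case: (graded_unitX a.+1 Uy3).
rewrite y0E; apply: gradedD.
  apply: gradedM Ty3ai _; first exact: graded_mul Tu Tg.
  have -> : e0 = du + e1 *+ a.+1 - e2 by rewrite duE; ring.
  by rewrite mulrnDl; ring.
apply: gradedM Ty3ai _.
  exact: graded_mul (graded_mul Tv Tu2i) Ty4.
have -> : e4 = du2 + e3 *+ a.+1 - e2 by rewrite du2E; ring.
by rewrite dvE; ring.
Qed.

(** [y1] and [y2] are comaximal, because [y1 * y3] is congruent to the unit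
    [v1] modulo [y2]. *)
Lemma rank2_intersection d f :
  (exists N : nat, T (d + e2 *+ N) (y2 ^+ N * f)) ->
  (exists N : nat, T (d + e1 *+ N) (y1 ^+ N * f)) -> T d f.
Proof.
move=> [N TN] [M TM].
case: Uy3 => y30 Ty3 Ty3i; case: (Uu1) => _ Tu1 _; case: (Uv1) => v10 Tv1 Tv1i.
apply: (graded_comaximal (p := y3 * v1^-1) (q := - (u1 * y2 ^+ a * v1^-1))
  rank2_y1 Ty2 _ _ _ TM TN).
- by apply: gradedM Ty3 Tv1i _; rewrite dv1E; ring.
- apply/gradedN/gradedM; [|exact: Tv1i|].
    exact: graded_mul Tu1 (gradedX a Ty2).
  by rewrite dv1E -du1E mulrS; ring.
have ->: y3 / v1 * y1 + - (u1 * y2 ^+ a / v1) * y2 =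
    (y1 * y3 - u1 * y2 ^+ a.+1) / v1 by rewrite exprSr; ring.
by rewrite y13 addrC addKr divff.
Qed.

End RankTwo.

End GradedSubring.

Lemma graded_subring_sub (F : fieldType) (G H : int -> F -> Prop) :
  (forall d a, G d a -> graded_subring H d a) ->
  forall d a, graded_subring G d a -> graded_subring H d a.
Proof.
move=> GH d a; elim=> {d a} [d a /GH //||d a b _ Ta _ Tb|d e a b _ Ta _ Tb].
- exact: graded_one.
- exact: graded_sub.
- exact: graded_mul.
Qed.

(** * Matrix and seed mutation *)

Lemma pos_part_ge0 a : 0 <= pos_part a.
Proof. by rewrite /pos_part le_max lexx. Qed.

Lemma pos_part_id a : 0 <= a -> pos_part a = a.
Proof. by rewrite /pos_part; lia. Qed.

Lemma pos_part_eq0 a : a <= 0 -> pos_part a = 0.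
Proof. by rewrite /pos_part; lia. Qed.

Section Seeds.

Variables (F : fieldType) (m n : nat) (le_nm : (n <= m)%N).
Local Notation w := (widen_ord le_nm).
Implicit Types (B : 'M[int]_(m, n)) (t : seed F m n) (k l : 'I_n).

Lemma skew_principal_partP B :
  skew_symmetric (principal_part le_nm B) <->
  (forall i j, B (w i) j = - B (w j) i).
Proof.
split=> [sk i j|sk]; last by apply/matrixP=> i j; rewrite !mxE sk.
by have /matrixP/(_ j i) := sk; rewrite !mxE.
Qed.

Lemma skew_diag0 B k :
  skew_symmetric (principal_part le_nm B) -> B (w k) k = 0.
Proof. by move/skew_principal_partP/(_ k k); lia. Qed.

(** With positive parts in place of the half-sum there is no division left:
    involutivity and skew-symmetry become ring identities. *)
Lemma mutate_mxE B k i j :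
  mutate_mx le_nm B k i j =
    if (i == w k) || (j == k) then - B i j
    else B i j + (pos_part (B i k) * pos_part (B (w k) j)
                  - pos_part (- B i k) * pos_part (- B (w k) j)).
Proof.
rewrite mxE; case: ifP => // _; congr (_ + _).
move: (B i k) (B (w k) j) => u v.
have [u_ge0|/ltW u_le0] := leP 0 u; have [v_ge0|/ltW v_le0] := leP 0 v.
- rewrite !ger0_norm // (pos_part_id u_ge0) (pos_part_id v_ge0).
  rewrite (@pos_part_eq0 (- u)) ?oppr_le0 // mul0r subr0.
  by rewrite (_ : u * v + u * v = u * v * 2) ?mulzK //; ring.
- rewrite ger0_norm // ler0_norm // (pos_part_eq0 v_le0).
  by rewrite (@pos_part_eq0 (- u)) ?oppr_le0 // mulr0 mul0r mulrN addrN div0z.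
- rewrite ler0_norm // ger0_norm // (pos_part_eq0 u_le0).
  by rewrite (@pos_part_eq0 (- v)) ?oppr_le0 // mulr0 mul0r mulNr addNr div0z.
- rewrite !ler0_norm // (pos_part_eq0 u_le0) (pos_part_eq0 v_le0) mul0r.
  rewrite !pos_part_id ?oppr_ge0 //.
  rewrite (_ : - u * v + u * - v = - (u * v) * 2) ?mulzK //; ring.
Qed.

Lemma mutate_mx_skew B k :
  skew_symmetric (principal_part le_nm B) ->
  skew_symmetric (principal_part le_nm (mutate_mx le_nm B k)).
Proof.
move=> /skew_principal_partP sk; apply/skew_principal_partP => i j.
have weq (a b : 'I_n) : (w a == w b) = (a == b).
  by rewrite -!val_eqE.
rewrite !mutate_mxE !weq orbC; case: ifP => [_|_]; first by rewrite sk.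
by rewrite (sk i j) (sk i k) (sk k j) !opprK; ring.
Qed.

Lemma mutate_mxK B k : B (w k) k = 0 ->
  mutate_mx le_nm (mutate_mx le_nm B k) k = B.
Proof.
move=> Bkk; apply/matrixP=> i j; rewrite mutate_mxE.
case: ifP => ij; first by rewrite mutate_mxE ij opprK.
by rewrite !mutate_mxE ij !eqxx orbT /= !opprK; ring.
Qed.

Definition exchange_sum (x : 'I_m -> F) B k : F :=
  \prod_(j < m) x j ^ pos_part (B j k) + \prod_(j < m) x j ^ pos_part (- B j k).

Lemma mutate_varE t k i :
  seed_var (mutate le_nm t k) i =
    if i == w k then (seed_var t (w k))^-1
                     * exchange_sum (seed_var t) (seed_mx t) k
    else seed_var t i.
Proof. by rewrite ffunE. Qed.

Lemma exchange_relation t k : seed_var t (w k) != 0 ->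
  seed_var t (w k) * seed_var (mutate le_nm t k) (w k) =
  exchange_sum (seed_var t) (seed_mx t) k.
Proof. by move=> x0; rewrite mutate_varE eqxx mulVKf. Qed.

Lemma mutate_varK t k : seed_mx t (w k) k = 0 ->
  exchange_sum (seed_var t) (seed_mx t) k != 0 ->
  mutate_var le_nm (mutate le_nm t k) k = seed_var t.
Proof.
move=> Bkk M0; apply/ffunP=> i.
have -> : mutate_var le_nm (mutate le_nm t k) k =
          seed_var (mutate le_nm (mutate le_nm t k) k) by [].
rewrite mutate_varE; case: eqP => [->|/eqP ik]; last first.
  by rewrite mutate_varE (negbTE ik).
have -> : exchange_sum (seed_var (mutate le_nm t k))
            (seed_mx (mutate le_nm t k)) k =
          exchange_sum (seed_var t) (seed_mx t) k.
  rewrite /exchange_sum addrC; congr (_ + _); apply: eq_bigr => j _;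
  rewrite mutate_mxE eqxx orbT ?opprK mutate_varE;
  by case: eqP => // ->; rewrite Bkk ?oppr0.
by rewrite mutate_varE eqxx invfM invrK -mulrA mulVf // mulr1.
Qed.

Definition nonzero_seed t := forall i, seed_var t i != 0.

Lemma exchange_sum_neq0 t k : nonzero_seed (mutate le_nm t k) ->
  exchange_sum (seed_var t) (seed_mx t) k != 0.
Proof.
by move=> /(_ (w k)); rewrite mutate_varE eqxx mulf_eq0 negb_or => /andP[].
Qed.

Lemma mutateK t k : skew_symmetric (principal_part le_nm (seed_mx t)) ->
  nonzero_seed (mutate le_nm t k) -> mutate le_nm (mutate le_nm t k) k = t.
Proof.
case: t => x B /= sk nz; rewrite {1}/mutate /=.
rewrite mutate_varK ?mutate_mxK //=; try exact: skew_diag0.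
exact: (exchange_sum_neq0 nz).
Qed.

End Seeds.

(** * Algebraic independence of the extended cluster *)

Section Independence.

Variable m : nat.
Local Notation eval := (@ratfun_eval m).

Definition alg_independent (x : {ffun 'I_m -> ratfun m}) : Prop :=
  forall P : {mpoly rat[m]}, eval x P = 0 -> P = 0.

Lemma evalD x P Q : eval x (P + Q) = eval x P + eval x Q.
Proof. exact: mmapD. Qed.

Lemma evalB x P Q : eval x (P - Q) = eval x P - eval x Q.
Proof. exact: mmapB. Qed.

Lemma evalM x P Q : eval x (P * Q) = eval x P * eval x Q.
Proof. exact: rmorphM. Qed.

Lemma evalXn x P N : eval x (P ^+ N) = eval x P ^+ N.
Proof. exact: rmorphXn. Qed.

Lemma eval1 x : eval x 1 = 1.
Proof. exact: rmorph1. Qed.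

Lemma evalC x c : eval x c%:MP = ratfunC m c.
Proof. exact: mmapC. Qed.

Lemma evalX x (e : 'X_{1..m}) : eval x 'X_[e] = \prod_(i < m) x i ^+ e i.
Proof. exact: mmapX. Qed.

Lemma evalU x i : eval x 'X_i = x i.
Proof. by rewrite /ratfun_eval mmapX mmap1U. Qed.

Lemma alg_independent_neq0 x i : alg_independent x -> x i != 0.
Proof.
move=> ind; apply/eqP; rewrite -(evalU x) => /ind/mpolyP/(_ U_(i)%MM)/eqP.
by rewrite mcoeffX eqxx mcoeff0 oner_eq0.
Qed.

Variables (n : nat) (le_nm : (n <= m)%N) (B : 'M[int]_(m, n)) (k : 'I_n).
Local Notation w := (widen_ord le_nm k).
Local Notation tau x := (seed_var (mutate le_nm (Seed x B) k)).

Definition exchange_poly : {mpoly rat[m]} :=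
  'X_[[multinom `|pos_part (B j k)|%N | j < m]]
  + 'X_[[multinom `|pos_part (- B j k)|%N | j < m]].

Lemma eval_exchange_poly x : eval x exchange_poly = exchange_sum x B k.
Proof.
rewrite evalD !evalX; congr (_ + _); apply: eq_bigr => j _; rewrite mnmE;
  by rewrite [LHS]exprnP gez0_abs ?pos_part_ge0.
Qed.

Lemma exchange_poly_neq0 : exchange_poly != 0.
Proof.
apply/eqP=> /mpolyP/(_ [multinom `|pos_part (B j k)|%N | j < m])/eqP.
by rewrite mcoeffD !mcoeffX eqxx mcoeff0 -natrD pnatr_eq0.
Qed.

(** The only denominator in [tau x] is [x w]. The polynomial [Q] is the same
    for all points [x]: it will be evaluated at two of them. *)
Lemma eval_mutate (P : {mpoly rat[m]}) :
  exists (N : nat) (Q : {mpoly rat[m]}), forall x : {ffun 'I_m -> ratfun m},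
    x w != 0 -> eval x Q = eval (tau x) P * x w ^+ N.
Proof.
pose good P := exists (N : nat) (Q : {mpoly rat[m]}),
  forall x : {ffun 'I_m -> ratfun m},
    x w != 0 -> eval x Q = eval (tau x) P * x w ^+ N.
have goodM P1 P2 : good P1 -> good P2 -> good (P1 * P2).
  move=> [N1 [Q1 Q1E]] [N2 [Q2 Q2E]]; exists (N1 + N2)%N, (Q1 * Q2) => x x0.
  by rewrite !evalM Q1E // Q2E // exprD mulrACA.
have goodD P1 P2 : good P1 -> good P2 -> good (P1 + P2).
  move=> [N1 [Q1 Q1E]] [N2 [Q2 Q2E]]; exists (N1 + N2)%N.
  exists (Q1 * 'X_w ^+ N2 + Q2 * 'X_w ^+ N1) => x x0.
  by rewrite !evalD !evalM !evalXn !evalU Q1E // Q2E // exprD; ring.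
have goodC c : good c%:MP.
  by exists 0%N, c%:MP => x _; rewrite !evalC mulr1.
have good_var i : good 'X_i.
  have [->|iw] := eqVneq i w; last first.
    exists 0%N, 'X_i => x _.
    by rewrite !evalU mutate_varE (negbTE iw) mulr1.
  exists 1%N, exchange_poly => x x0.
  by rewrite eval_exchange_poly evalU mutate_varE eqxx /= expr1 mulrC mulVKf.
elim/mpolyind: P => [|c e P _ _ goodP]; first exact: (goodC 0).
apply: goodD => //; rewrite -mul_mpolyC; apply: (goodM) => //.
rewrite mpolyXE_id; apply: (big_ind good) => [|P1 P2|i _].
- exact: (goodC 1).
- exact: goodM.
by elim: (e i) => [|d IHd]; [exact: (goodC 1) | rewrite exprS; exact: goodM].
Qed.

End Independence.

(** A relation [P] between the mutated variables gives, by [eval_mutate], a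
    polynomial [Q] vanishing at the old variables, so [Q = 0]; evaluating [Q]
    at the mutated variables, whose own mutation is the old point, shows that
    [P] vanishes at the old variables. *)
Lemma alg_independent_mutate (m n : nat) (le_nm : (n <= m)%N)
    (t : seed (ratfun m) m n) (k : 'I_n) :
  skew_symmetric (principal_part le_nm (seed_mx t)) ->
  alg_independent (seed_var t) ->
  alg_independent (seed_var (mutate le_nm t k)).
Proof.
move=> sk ind P Pt0.
have nz i : seed_var t i != 0 by apply: alg_independent_neq0.
have M0 : exchange_sum (seed_var t) (seed_mx t) k != 0.
  rewrite -eval_exchange_poly; apply/eqP=> /ind/eqP.
  exact/negP/exchange_poly_neq0.
have [N [Q QE]] := eval_mutate le_nm (seed_mx t) k P.
have seedE : Seed (seed_var t) (seed_mx t) = t by case: (t).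
have Q0 : Q = 0 by apply: ind; rewrite QE // seedE Pt0 mul0r.
pose y := seed_var (mutate le_nm t k).
have y0 : y (widen_ord le_nm k) != 0.
  by rewrite /y mutate_varE eqxx mulf_neq0 ?invr_eq0.
have := QE y y0; rewrite Q0 /ratfun_eval mmap0 => /esym/eqP.
rewrite mulf_eq0 expf_eq0 (negbTE y0) andbF orbF.
have -> : seed_var (mutate le_nm (Seed y (seed_mx t)) k) = seed_var t.
  rewrite -[RHS](mutate_varK (le_nm := le_nm) (k := k)) ?skew_diag0 //.
  apply/ffunP=> i; rewrite !ffunE /=; case: eqP => // _.
  congr (_ * _); rewrite addrC; congr (_ + _); apply: eq_bigr => j _;
    by rewrite mutate_mxE eqxx orbT ?opprK.
by move/eqP/ind.
Qed.


(** * The graded upper bound of a seed *)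

Section UpperBound.

Variables (F : fieldType) (m n : nat) (le_nm : (n <= m)%N).
Variable deg : seed F m n -> 'I_m -> int.
Local Notation w := (widen_ord le_nm).
Local Notation skew t := (skew_symmetric (principal_part le_nm (seed_mx t))).
Implicit Types (t : seed F m n) (k l : 'I_n).

(** Generators of the ring of the functions that are Laurent in the variables
    other than [x_k] and polynomial in [x_k] and its mutation. *)
Definition adjacent_gen t k (d : int) (f : F) : Prop :=
  [\/ exists2 i, i != w k & (d = deg t i /\ f = seed_var t i) \/
                            (d = - deg t i /\ f = (seed_var t i)^-1),
      d = deg t (w k) /\ f = seed_var t (w k)
    | d = deg (mutate le_nm t k) (w k) /\
      f = seed_var (mutate le_nm t k) (w k)].

Definition adjacent_ring t k := graded_subring (adjacent_gen t k).

(** This is the description by generators of the upper bound of Berenstein,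
    Fomin and Zelevinsky; unlike the intersection of Laurent rings it makes
    the passage to an adjacent seed a statement on generators. *)
Definition upper_bound t d f := forall k, adjacent_ring t k d f.

Definition homogeneous_exchange t k :=
  [/\ forall i, i != w k -> deg (mutate le_nm t k) i = deg t i,
      \sum_i deg t i * pos_part (seed_mx t i k) =
        deg t (w k) + deg (mutate le_nm t k) (w k)
    & \sum_i deg t i * pos_part (- seed_mx t i k) =
        deg t (w k) + deg (mutate le_nm t k) (w k)].

Lemma adjacent_ring_unit t k i : nonzero_seed t -> i != w k ->
  graded_unit (adjacent_gen t k) (deg t i) (seed_var t i).
Proof.
by move=> nz ik; split=> //; apply: graded_in; constructor 1; exists i; auto.
Qed.

Lemma adjacent_ring_var t k i : nonzero_seed t ->
  adjacent_ring t k (deg t i) (seed_var t i).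
Proof.
move=> nz; have [->|ik] := eqVneq i (w k).
  by apply: graded_in; constructor 2.
by case: (adjacent_ring_unit nz ik).
Qed.

Lemma adjacent_ring_new t k :
  adjacent_ring t k (deg (mutate le_nm t k) (w k))
    (seed_var (mutate le_nm t k) (w k)).
Proof. by apply: graded_in; constructor 3. Qed.

Lemma adjacent_ring_exchange t k l :
  nonzero_seed t -> homogeneous_exchange t l ->
  adjacent_ring t k (deg (mutate le_nm t l) (w l))
    (seed_var (mutate le_nm t l) (w l)).
Proof.
move=> nz hl; have [->|lk] := eqVneq l k; first exact: adjacent_ring_new.
have [_ deg_pos deg_neg] := hl.
have [_ _ Txl] :
    graded_unit (adjacent_gen t k) (deg t (w l)) (seed_var t (w l)).
  by apply: adjacent_ring_unit; rewrite // -val_eqE.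
have -> : deg (mutate le_nm t l) (w l) =
    - deg t (w l) + (deg t (w l) + deg (mutate le_nm t l) (w l)) by ring.
rewrite mutate_varE eqxx; apply: graded_mul => //; apply: gradedD.
  rewrite -deg_pos; apply: graded_prod => i; first exact: pos_part_ge0.
  exact: adjacent_ring_var.
rewrite -deg_neg; apply: graded_prod => i; first exact: pos_part_ge0.
exact: adjacent_ring_var.
Qed.

Lemma upper_bound_var t i : nonzero_seed t ->
  upper_bound t (deg t i) (seed_var t i).
Proof. by move=> nz k; apply: adjacent_ring_var. Qed.

(* The sign [b] selects one of the two exchange monomials, which allows the
   two orientations of the arrows between [k] and [l] to be treated at once. *)
Let spart (b : bool) (a : int) := pos_part (if b then - a else a).

Let spartC b a : spart (~~ b) a = spart b (- a).
Proof. by case: b; rewrite /spart /= ?opprK. Qed.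

Let exchange_sumE b (x : 'I_m -> F) (B : 'M[int]_(m, n)) k :
  exchange_sum x B k = \prod_(j < m) x j ^ spart b (B j k)
                       + \prod_(j < m) x j ^ spart (~~ b) (B j k).
Proof. by case: b; rewrite // addrC. Qed.

Let homogeneous_exchangeE b t k : homogeneous_exchange t k ->
  \sum_i deg t i * spart b (seed_mx t i k) =
    deg t (w k) + deg (mutate le_nm t k) (w k).
Proof. by case: b => -[]. Qed.

Section Step.

Variables (t : seed F m n) (k l : 'I_n) (a : nat) (b : bool).
Hypotheses (kl : k != l) (sk : skew t).
Hypotheses (nz : nonzero_seed t) (nz1 : nonzero_seed (mutate le_nm t k)).
Hypotheses (hk : homogeneous_exchange t k) (hl : homogeneous_exchange t l).
Hypothesis (hkl : homogeneous_exchange (mutate le_nm t k) l).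
Hypothesis Blk : seed_mx t (w l) k = if b then - a.+1%:Z else a.+1%:Z.

Local Notation x := (seed_var t).
Local Notation B := (seed_mx t).
Local Notation t1 := (mutate le_nm t k).
Local Notation B1 := (seed_mx t1).
Let off j := (j != w k) && (j != w l).
Let mono (c : bool) (s : 'I_n) (B : 'M[int]_(m, n)) :=
  \prod_(j | off j) x j ^ spart c (B j s).
Let wdeg (c : bool) (s : 'I_n) (B : 'M[int]_(m, n)) :=
  \sum_(j | off j) deg t j * spart c (B j s).
Let T := adjacent_ring t1 l.

Let wkl : w k != w l.
Proof. by rewrite -val_eqE. Qed.

Let x1E i : i != w k -> seed_var t1 i = x i.
Proof. by move=> ik; rewrite mutate_varE (negbTE ik). Qed.

Let deg1E i : i != w k -> deg t1 i = deg t i.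
Proof. by case: hk => h _ _; apply: h. Qed.

Let mono_unit c s B' :
  graded_unit (adjacent_gen t1 l) (wdeg c s B') (mono c s B').
Proof.
apply: graded_unit_prod => j /andP[jk jl].
by rewrite -x1E // -deg1E //; apply: adjacent_ring_unit.
Qed.

Let Bkl : B (w k) l = if b then a.+1%:Z else - a.+1%:Z.
Proof.
by move/skew_principal_partP: sk => ->; rewrite Blk; case: b; rewrite ?opprK.
Qed.

Let prod_split (f : 'I_m -> F) :
  \prod_j f j = f (w k) * f (w l) * \prod_(j | off j) f j.
Proof.
by rewrite (bigD1 (w k)) // (bigD1 (w l)) ?(eq_sym (w l)) //= mulrA.
Qed.

Let sum_split (f : 'I_m -> int) :
  \sum_j f j = f (w k) + f (w l) + \sum_(j | off j) f j.
Proof.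
by rewrite (bigD1 (w k)) // (bigD1 (w l)) ?(eq_sym (w l)) //= addrA.
Qed.

Let spart_a : spart b (if b then - a.+1%:Z else a.+1%:Z) = a.+1%:Z.
Proof. by rewrite /spart /pos_part; case: b; rewrite ?opprK; lia. Qed.

Let spart_Na : spart b (if b then a.+1%:Z else - a.+1%:Z) = 0.
Proof. by rewrite /spart /pos_part; case: b; rewrite ?opprK; lia. Qed.

Let ifN (c : bool) (z : int) : (- if c then z else - z) = if c then - z else z.
Proof. by case: c; rewrite ?opprK. Qed.

Let ifN' (c : bool) (z : int) : (- if c then - z else z) = if c then z else - z.
Proof. by case: c; rewrite ?opprK. Qed.

Let spart0 c : spart c 0 = 0.
Proof. by case: c; rewrite /spart /pos_part ?oppr0. Qed.

Let B1E j : j != w k ->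
  B1 j l = B j l + (if b then a.+1%:Z else - a.+1%:Z) * spart (~~ b) (B j k).
Proof.
move=> jk; rewrite mutate_mxE (negbTE jk) eq_sym (negbTE kl) /= Bkl /spart.
have pa : pos_part a.+1 = a.+1 by apply: pos_part_id.
have pNa : pos_part (- a.+1%:Z) = 0 by apply: pos_part_eq0; rewrite oppr_le0.
by case: (b); rewrite /= ?opprK pa pNa; ring.
Qed.

(* The frozen part of the exchange ratio of column [l] after mutation at [k]
   differs from the one before by a power of a monomial of column [k]. *)
Let coef_eq : mono (~~ b) l B1 * mono b l B =
  mono b l B1 * mono (~~ b) l B * mono (~~ b) k B ^+ a.+1.
Proof.
rewrite /mono -prodrXl -!big_split /=; apply: eq_bigr => j /andP[jk _].
have xj0 := nz j.
rewrite exprnP exprz_exp -!expfzDr //; congr (_ ^ _).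
rewrite B1E // /spart; case: (b) => /=; rewrite /pos_part; nia.
Qed.

Let Bkk : B (w k) k = 0. Proof. exact: skew_diag0. Qed.
Let Bll : B (w l) l = 0. Proof. exact: skew_diag0. Qed.
Let B1ll : B1 (w l) l = 0.
Proof. by apply: skew_diag0; apply: mutate_mx_skew. Qed.
Let B1kl : B1 (w k) l = - B (w k) l.
Proof. by rewrite mutate_mxE eqxx. Qed.

Let y1 := x (w k).
Let y2 := x (w l).
Let y3 := seed_var t1 (w k).
Let y0 := seed_var (mutate le_nm t l) (w l).
Let y4 := seed_var (mutate le_nm t1 l) (w l).

Let y13 : y1 * y3 = mono b k B * y2 ^+ a.+1 + mono (~~ b) k B.
Proof.
rewrite /y1 /y3 exchange_relation // (exchange_sumE b) !prod_split Bkk Blk.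
rewrite !spartC !ifN' spart_a spart_Na !oppr0 !spart0 !expr0z !mul1r.
by rewrite mulrC -exprnP; congr (_ + _); apply: eq_bigr => j _; rewrite spartC.
Qed.

Let y20 : y2 * y0 = mono (~~ b) l B * y1 ^+ a.+1 + mono b l B.
Proof.
rewrite /y2 /y0 exchange_relation // (exchange_sumE b) !prod_split Bll Bkl.
rewrite !spartC !ifN spart_a spart_Na !oppr0 !spart0 !expr0z !mul1r mulr1.
by rewrite addrC mulrC -exprnP.
Qed.

Let y24 : y2 * y4 = mono b l B1 * y3 ^+ a.+1 + mono (~~ b) l B1.
Proof.
have -> : y2 = seed_var t1 (w l) by rewrite x1E // eq_sym.
rewrite /y4 exchange_relation // (exchange_sumE b) !prod_split B1ll B1kl Bkl.
rewrite !spartC !ifN !ifN' spart_a spart_Na !oppr0 !spart0 !expr0z !mul1r mulr1.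
rewrite mulrC -exprnP; congr (_ * _ + _); apply: eq_bigr => j /andP[jk _];
  by rewrite ?spartC x1E.
Qed.

Let e1 := deg t (w k).
Let e2 := deg t (w l).
Let e3 := deg t1 (w k).
Let e0 := deg (mutate le_nm t l) (w l).
Let e4 := deg (mutate le_nm t1 l) (w l).

Let degk c : e1 * spart c (B (w k) k) + e2 * spart c (B (w l) k) + wdeg c k B =
  e1 + e3.
Proof. by rewrite -(homogeneous_exchangeE c hk) sum_split. Qed.

Let degl c : e1 * spart c (B (w k) l) + e2 * spart c (B (w l) l) + wdeg c l B =
  e2 + e0.
Proof. by rewrite -(homogeneous_exchangeE c hl) sum_split. Qed.

Let deg1l c :
  e3 * spart c (B1 (w k) l) + e2 * spart c (B1 (w l) l) + wdeg c l B1 =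
  e2 + e4.
Proof.
have e2E : e2 = deg t1 (w l) by rewrite deg1E // eq_sym.
rewrite {2}e2E -(homogeneous_exchangeE c hkl) sum_split -e2E; congr (_ + _).
by apply: eq_bigr => j /andP[jk _]; rewrite deg1E.
Qed.

(** The indices [k] and [l] span a rank two mutation class in which all other
    variables are coefficients: [adjacent_ring t k] and [adjacent_ring t l]
    map to [adjacent_ring t1 l] after inverting [y2] and [y1] respectively,
    and these two elements are comaximal there. *)
Lemma adjacent_ring_step d f :
  adjacent_ring t k d f -> adjacent_ring t l d f -> adjacent_ring t1 l d f.
Proof.
move=> Tk Tl.
have Ty2 : T e2 y2.
  rewrite /e2 /y2 -x1E 1?eq_sym // -deg1E 1?eq_sym //.
  exact: adjacent_ring_var.
have Uy3 : graded_unit (adjacent_gen t1 l) e3 y3 by apply: adjacent_ring_unit.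
have Ty4 : T e4 y4 by apply: adjacent_ring_new.
have du1E : wdeg b k B + e2 *+ a.+1 = e1 + e3.
  by rewrite -(degk b) Bkk Blk spart_a spart0 -mulrzz; ring.
have dv1E : wdeg (~~ b) k B = e1 + e3.
  by rewrite -(degk (~~ b)) !spartC Bkk Blk ifN' spart_Na oppr0 spart0; ring.
have duE : wdeg (~~ b) l B + e1 *+ a.+1 = e2 + e0.
  rewrite -(degl (~~ b)) !spartC Bll Bkl ifN spart_a oppr0 spart0 -mulrzz.
  by ring.
have dvE : wdeg b l B = e2 + e0.
  by rewrite -(degl b) Bll Bkl spart_Na spart0; ring.
have du2E : wdeg b l B1 + e3 *+ a.+1 = e2 + e4.
  by rewrite -(deg1l b) B1ll B1kl Bkl ifN spart_a spart0 -mulrzz; ring.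
have Ty1 := rank2_y1 Ty2 Uy3 (mono_unit b k B) (mono_unit (~~ b) k B)
  y13 du1E dv1E.
have Ty0 := rank2_y0 Ty2 (nz (w l)) Uy3 Ty4 (mono_unit (~~ b) l B)
  (mono_unit b l B) (mono_unit b k B) (mono_unit (~~ b) k B)
  (mono_unit b l B1) y13 y20 y24 coef_eq du1E dv1E duE dvE du2E.
have Uother i : off i -> graded_unit (adjacent_gen t1 l) (deg t i) (x i).
  by move=> /andP[ik il]; rewrite -x1E // -deg1E //; apply: adjacent_ring_unit.
have shift0 d' f' : T d' f' -> forall e z, exists N : nat,
    T (d' + e *+ N) (z ^+ N * f').
  by move=> Tf e z; exists 0%N; rewrite mulr0n addr0 expr0 mul1r.
apply: (rank2_intersection Ty2 Uy3 (mono_unit b k B) (mono_unit (~~ b) k B)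
   y13 du1E dv1E).
- apply: (graded_subring_denominator Ty2) Tk => d' f' [].
  + move=> [i ik]; have [->|il] := eqVneq i (w l).
      case=> -[-> ->]; first exact: shift0.
      exists 1%N; rewrite addNr mulfV ?nz //; exact: graded_one.
    have [_ Ti Tiv] : graded_unit (adjacent_gen t1 l) (deg t i) (x i).
      by apply: Uother; rewrite /off ik.
    by case=> -[-> ->]; apply: shift0.
  + by move=> [-> ->]; apply: shift0.
  + by move=> [-> ->]; apply: shift0; case: Uy3.
- apply: (graded_subring_denominator Ty1) Tl => d' f' [].
  + move=> [i il]; have [->|ik] := eqVneq i (w k).
      case=> -[-> ->]; first exact: shift0.
      exists 1%N; rewrite addNr mulfV ?nz //; exact: graded_one.
    have [_ Ti Tiv] : graded_unit (adjacent_gen t1 l) (deg t i) (x i).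
      by apply: Uother; rewrite /off ik.
    by case=> -[-> ->]; apply: shift0.
  + by move=> [-> ->]; apply: shift0.
  + by move=> [-> ->]; apply: shift0.
Qed.

End Step.

(** For [l = k] the two rings coincide, because mutation is an involution; for
    the other [l] this is [adjacent_ring_step]. *)
Lemma upper_bound_mutate t k d f :
  skew t -> nonzero_seed t -> nonzero_seed (mutate le_nm t k) ->
  (forall l, homogeneous_exchange t l) ->
  (forall l, homogeneous_exchange (mutate le_nm t k) l) ->
  (forall l, l != k -> seed_mx t (w l) k != 0) ->
  upper_bound t d f -> upper_bound (mutate le_nm t k) d f.
Proof.
move=> sk nz nz1 h h1 B0 Uf l; have [->|lk] := eqVneq l k.
  apply: (graded_subring_sub _ (Uf k)) => d' f' gen; apply: graded_in.
  have [degE _ _] := h k.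
  case: gen => [[i ik fE]||] .
  - constructor 1; exists i => //.
    by rewrite degE // mutate_varE (negbTE ik).
  - by constructor 3; rewrite mutateK.
  - by constructor 2.
have := B0 l lk; case Blk: (seed_mx t (w l) k) => [[|a]|a] // _.
  by apply: (@adjacent_ring_step t k l a false); rewrite // eq_sym.
by apply: (@adjacent_ring_step t k l a true); rewrite // eq_sym.
Qed.

End UpperBound.

(** * Laurent polynomials with prescribed exponents *)

Section LaurentSupport.

Variables (m : nat) (x : {ffun 'I_m -> ratfun m}).
Hypothesis x_indep : alg_independent x.
Local Notation eval := (ratfun_eval x).
Implicit Types (E : {ffun 'I_m -> int} -> Prop) (a b : {ffun 'I_m -> int}).

Definition mnm_vec (e : 'X_{1..m}) : {ffun 'I_m -> int} :=
  [ffun i => (e i)%:Z].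

Lemma mnm_vecD e e' : mnm_vec (e + e')%MM = mnm_vec e + mnm_vec e'.
Proof. by apply/ffunP=> i; rewrite !ffunE mnmDE PoszD. Qed.

(** The expansion is existential: for closure under the ring operations no
    uniqueness is needed, and it is only in [laurent_support_one] that
    independence of [x] makes the exponents well defined. *)
Definition laurent_support E (f : ratfun m) : Prop :=
  exists e (P : {mpoly rat[m]}), f * eval 'X_[e] = eval P /\
    forall e', e' \in msupp P -> E (mnm_vec e' - mnm_vec e).

Definition delta_vec (i : 'I_m) : {ffun 'I_m -> int} := [ffun j => (i == j)%:Z].

Lemma laurent_supportS E E' f : (forall a, E a -> E' a) ->
  laurent_support E f -> laurent_support E' f.
Proof.
by move=> EE' [e [P [fP EP]]]; exists e, P; split=> // e' /EP; apply: EE'.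
Qed.

Lemma laurent_support1 E : E 0 -> laurent_support E 1.
Proof.
move=> E0; exists 0%MM, 1; split; first by rewrite mpolyX0 mul1r.
by move=> e; rewrite msupp1 inE => /eqP->; rewrite subrr.
Qed.

Lemma laurent_supportB E f g :
  laurent_support E f -> laurent_support E g -> laurent_support E (f - g).
Proof.
move=> [e [P [fP EP]]] [e' [Q [gQ EQ]]].
exists (e + e')%MM, (P * 'X_[e'] - Q * 'X_[e]); split.
  by rewrite mpolyXD evalB !evalM -fP -gQ; ring.
move=> e'' /msuppB_le; rewrite mem_cat => /orP[].
  rewrite (perm_mem (msuppMX _ _)) => /mapP[e0 /EP + ->].
  rewrite (_ : mnm_vec (e' + e0) - _ = mnm_vec e0 - mnm_vec e) //.
  by apply/ffunP=> j; rewrite !mnm_vecD !ffunE; ring.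
rewrite (perm_mem (msuppMX _ _)) => /mapP[e0 /EQ + ->].
rewrite (_ : mnm_vec (e + e0) - _ = mnm_vec e0 - mnm_vec e') //.
by apply/ffunP=> j; rewrite !mnm_vecD !ffunE; ring.
Qed.

Lemma laurent_supportD E f g :
  laurent_support E f -> laurent_support E g -> laurent_support E (f + g).
Proof.
move=> Lf Lg; have -> : f + g = f - (g - g - g) by rewrite subrr sub0r opprK.
by do 2!apply: laurent_supportB => //; apply: laurent_supportB.
Qed.

Lemma laurent_supportM E1 E2 E f g :
  (forall a b, E1 a -> E2 b -> E (a + b)) ->
  laurent_support E1 f -> laurent_support E2 g -> laurent_support E (f * g).
Proof.
move=> EE [e [P [fP EP]]] [e' [Q [gQ EQ]]].
exists (e + e')%MM, (P * Q); split.
  by rewrite mpolyXD !evalM -fP -gQ; ring.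
move=> e'' /msuppM_le /allpairsP[[a b] /= [/EP Ea /EQ Eb ->]].
rewrite (_ : _ - _ = mnm_vec a - mnm_vec e + (mnm_vec b - mnm_vec e')).
  exact: EE.
by apply/ffunP=> j; rewrite !mnm_vecD !ffunE; ring.
Qed.

(** If [1 = P / x^e] then [P] is the monomial of exponent [e], by algebraic
    independence; other monomials reduce to this case by division. *)
Lemma laurent_support_one E : laurent_support E 1 -> E 0.
Proof.
move=> [e [P [fP EP]]]; have PE : P = 'X_[e].
  apply/eqP; rewrite -subr_eq0; apply/eqP/x_indep.
  by rewrite evalB -fP mul1r subrr.
by rewrite -(subrr (mnm_vec e)); apply: EP; rewrite PE msuppX mem_head.
Qed.

Definition laurent_monomial a f :=
  laurent_support (eq^~ a) f /\ laurent_support (eq^~ (- a)) f^-1.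

Lemma laurent_monomial1 : laurent_monomial 0 1.
Proof. by split; rewrite ?invr1; apply: laurent_support1; rewrite ?oppr0. Qed.

Lemma laurent_monomialM a b f g : laurent_monomial a f ->
  laurent_monomial b g -> laurent_monomial (a + b) (f * g).
Proof.
move=> [fa fa'] [gb gb']; split.
  by apply: laurent_supportM fa gb => _ _ -> ->.
by rewrite invfM; apply: laurent_supportM fa' gb' => _ _ -> ->; rewrite opprD.
Qed.

Lemma laurent_monomialV a f :
  laurent_monomial a f -> laurent_monomial (- a) f^-1.
Proof. by move=> [fa fa']; split; rewrite ?opprK ?invrK. Qed.

Lemma laurent_monomialX a f (N : nat) :
  laurent_monomial a f -> laurent_monomial (a *+ N) (f ^+ N).
Proof.
move=> fa; elim: N => [|N IHN]; first exact: laurent_monomial1.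
by rewrite exprS mulrS; apply: laurent_monomialM.
Qed.

Lemma laurent_monomialXz a f (z : int) :
  laurent_monomial a f -> laurent_monomial (a *~ z) (f ^ z).
Proof.
move=> fa; case: z => N; first exact: laurent_monomialX.
by rewrite NegzE mulrNz; apply/laurent_monomialV/laurent_monomialX.
Qed.

Lemma laurent_monomial_var i : laurent_monomial (delta_vec i) (x i).
Proof.
split.
  exists 0%MM, 'X_i; split; first by rewrite mpolyX0 eval1 mulr1 evalU.
  move=> e; rewrite msuppX inE => /eqP->; apply/ffunP=> j.
  by rewrite !ffunE mnm0E subr0 mnm1E; case: eqP.
exists U_(i)%MM, 1; split.
  by rewrite eval1 evalU mulVf // alg_independent_neq0.
move=> e; rewrite msupp1 inE => /eqP->; apply/ffunP=> j.
by rewrite !ffunE mnm0E sub0r mnm1E.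
Qed.

Lemma laurent_monomial_prod (P : pred 'I_m) (c : 'I_m -> int) :
  laurent_monomial [ffun i => if P i then c i else 0]
    (\prod_(i | P i) x i ^ c i).
Proof.
have -> : [ffun i => if P i then c i else 0] =
    \sum_(i | P i) delta_vec i *~ c i.
  apply/ffunP=> j; rewrite ffunE sum_ffunE; case: ifP => Pj.
    rewrite (bigD1 j) //= big1 ?addr0 => [|i /andP[_ ij]].
      by rewrite ffunMzE ffunE eqxx mulrzz mul1r.
    by rewrite ffunMzE ffunE (negbTE ij) mul0rz.
  rewrite big1 // => i Pi; rewrite ffunMzE ffunE.
  have [ij|_] := eqVneq i j; last by rewrite mul0rz.
  by rewrite -ij Pi in Pj.
apply: (big_rec2 (fun f a => laurent_monomial a f)).
  exact: laurent_monomial1.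
by move=> i a f _ fa; apply: laurent_monomialM => //;
  apply/laurent_monomialXz/laurent_monomial_var.
Qed.

Lemma laurent_support_monomial E a f : f != 0 ->
  laurent_monomial a f -> laurent_support E f -> E a.
Proof.
move=> f0 [_ La] Lf; rewrite -[a]add0r.
apply: (laurent_support_one (E := fun b => E (b + a))).
rewrite -(mulfV f0); apply: laurent_supportM Lf La => b _ Eb ->.
by rewrite subrK.
Qed.

Lemma graded_laurent_support (wt : {ffun 'I_m -> int} -> int) G d f :
  wt 0 = 0 -> {morph wt : a b / a + b} ->
  (forall d f, G d f -> laurent_support (fun a => wt a = d) f) ->
  graded_subring G d f -> laurent_support (fun a => wt a = d) f.
Proof.
move=> wt0 wtD LG; elim=> {d f} [d f /LG //||d f g _ Lf _ Lg|d e f g _ Lf _ Lg].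
- exact: laurent_support1.
- exact: laurent_supportB.
- by apply: laurent_supportM Lf Lg => a b <- <-.
Qed.

End LaurentSupport.

Section LaurentGen.

Variables (F : fieldType) (m n : nat) (le_nm : (n <= m)%N).
Variable deg : seed F m n -> 'I_m -> int.
Local Notation w := (widen_ord le_nm).
Implicit Types (t : seed F m n) (k l : 'I_n).

Definition laurent_gen t (d : int) (f : F) : Prop :=
  exists i, (d = deg t i /\ f = seed_var t i) \/
            (d = - deg t i /\ f = (seed_var t i)^-1).

Lemma laurent_gen_unit t i : nonzero_seed t ->
  graded_unit (laurent_gen t) (deg t i) (seed_var t i).
Proof. by move=> nz; split=> //; apply: graded_in; exists i; auto. Qed.

Lemma adjacent_ring_laurent t k d f : nonzero_seed t ->
  homogeneous_exchange le_nm deg t k ->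
  adjacent_ring le_nm deg t k d f -> graded_subring (laurent_gen t) d f.
Proof.
move=> nz [_ deg_pos deg_neg].
apply: graded_subring_sub => {}d {}f [[i _ fi]|[-> ->]|[-> ->]].
- by apply: graded_in; exists i.
- by case: (laurent_gen_unit (w k) nz).
have Umono (c : 'I_m -> int) := graded_unit_prod c
  (fun i (_ : xpredT i) => laurent_gen_unit i nz).
have [_ _ Txk] := laurent_gen_unit (w k) nz.
have -> : deg (mutate le_nm t k) (w k) =
    - deg t (w k) + (deg t (w k) + deg (mutate le_nm t k) (w k)) by ring.
rewrite mutate_varE eqxx; apply: graded_mul => //; apply: gradedD.
  by rewrite -deg_pos; case: (Umono (fun j => pos_part (seed_mx t j k))).
by rewrite -deg_neg; case: (Umono (fun j => pos_part (- seed_mx t j k))).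
Qed.

Lemma laurent_gen_ring s t d f :
  (forall i : 'I_m, (n <= i)%N -> seed_var t i = seed_var s i) ->
  graded_subring (laurent_gen t) d f -> laurent_ring le_nm s t f.
Proof.
move=> frozen; elim=> {d f} [d f||d f g _ Lf _ Lg|d e f g _ Lf _ Lg].
- move=> [i]; have [lt_in|le_ni] := ltnP i n.
    have -> : i = w (Ordinal lt_in) by apply: val_inj.
    case=> -[_ ->]; apply: gen_in; right; [left|right];
      exists (Ordinal lt_in) => //; exact: invrK.
  by case=> -[_ ->]; apply: gen_in; left; apply: gen_in; exists i;
    rewrite ?frozen //; auto.
- exact: gen_one.
- exact: gen_sub.
- exact: gen_mul.
Qed.

End LaurentGen.

(** * Cyclic exchange matrices of rank three *)

Lemma ord3_cases (i : 'I_3) : [\/ i = 0, i = 1 | i = 2%:R].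
Proof.
by case: i => [[|[|[|//]]] lt]; [constructor 1|constructor 2|constructor 3];
  apply: val_inj.
Qed.

Definition cyclic_mx (C : 'M[int]_3) : Prop :=
  forall i j k : 'I_3, uniq [:: i; j; k] -> 0 < C i j * C j k.

(** A sign pattern other than the two cyclic ones orients the triangle along a
    linear order of the vertices, and a rank function excludes cycles. *)
Lemma nonacyclic_cyclic (C : 'M[int]_3) :
  C^T = - C -> ~ acyclic_mx C -> cyclic_mx C.
Proof.
move=> sk nac.
have skE i j : C i j = - C j i by move/matrixP/(_ j i): sk; rewrite !mxE.
have ranked (h : 'I_3 -> nat) : ~ (forall i j, 0 < C i j -> (h i < h j)%N).
  move=> hC; apply: nac => c c0; apply/negP.
  case: c c0 => [//|i c] _; rewrite /cycle => pc.
  have tr : transitive (fun a b => (h a < h b)%N).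
    by move=> a b d; apply: ltn_trans.
  have : path (fun a b => (h a < h b)%N) i (rcons c i).
    by apply: sub_path pc => a b; apply: hC.
  by rewrite (path_sortedE tr) all_rcons ltnn.
have ranked3 (a b c : nat) :
    ~~ [&& (0 < C 0 1) ==> (a < b)%N, (0 < C 1 0) ==> (b < a)%N,
           (0 < C 1 2%:R) ==> (b < c)%N, (0 < C 2%:R 1) ==> (c < b)%N,
           (0 < C 0 2%:R) ==> (a < c)%N & (0 < C 2%:R 0) ==> (c < a)%N].
  apply/negP=> /and5P[/implyP h01 /implyP h10 /implyP h12 /implyP h21].
  case/andP=> /implyP h02 /implyP h20.
  pose h (i : 'I_3) := nth 0%N [:: a; b; c] i.
  apply: (ranked h) => i j.
  have d i' : 0 < C i' i' = false by have := skE i' i'; lia.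
  by case: (ord3_cases i) => ->; case: (ord3_cases j) => ->; rewrite ?d.
have s01 := skE 1 0; have s12 := skE 2%:R 1; have s20 := skE 0 2%:R.
have [[h01 h12 h20]|[h01 h12 h20]] :
    [/\ 0 < C 0 1, 0 < C 1 2%:R & 0 < C 2%:R 0] \/
    [/\ C 0 1 < 0, C 1 2%:R < 0 & C 2%:R 0 < 0].
  move: (ranked3 0 1 2)%N (ranked3 0 2 1)%N (ranked3 1 0 2)%N.
  move: (ranked3 1 2 0)%N (ranked3 2 0 1)%N (ranked3 2 1 0)%N.
  rewrite s01 s12 s20 !oppr_gt0.
  by case: (ltrgtP (C 0 1) 0) => _; case: (ltrgtP (C 1 2%:R) 0) => _;
    case: (ltrgtP (C 2%:R 0) 0) => _ //= *; [right|left].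
all: move=> i j k; case: (ord3_cases i) => ->; case: (ord3_cases j) => ->;
  case: (ord3_cases k) => -> //= _; rewrite ?s01 ?s12 ?s20; nia.
Qed.

Lemma uniq3_cases (i j k : 'I_3) : uniq [:: i; j; k] ->
  forall l, [\/ l = i, l = j | l = k].
Proof.
case: (ord3_cases i) => ->; case: (ord3_cases j) => ->;
  case: (ord3_cases k) => -> // _ l; case: (ord3_cases l) => ->;
  by [constructor 1|constructor 2|constructor 3].
Qed.

Lemma big_ord3 (R : Type) (idx : R) (op : Monoid.com_law idx)
    (f : 'I_3 -> R) i j k : uniq [:: i; j; k] ->
  \big[op/idx]_(s < 3) f s = op (op (f i) (f j)) (f k).
Proof.
have -> : \big[op/idx]_(s < 3) f s = op (op (f 0) (f 1)) (f 2%:R).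
  rewrite !big_ord_recl big_ord0 Monoid.mulm1 Monoid.mulmA.
  by congr (op (op (f _) (f _)) (f _)); apply: val_inj.
case: (ord3_cases i) => ->; case: (ord3_cases j) => ->;
  case: (ord3_cases k) => -> // _.
- by rewrite Monoid.mulmAC.
- by congr (op _ _); rewrite Monoid.mulmC.
- by rewrite [RHS]Monoid.mulmC Monoid.mulmA.
- by rewrite [LHS]Monoid.mulmC Monoid.mulmA.
- by rewrite [RHS]Monoid.mulmC [op (f 2%:R) _]Monoid.mulmC Monoid.mulmA.
Qed.

Lemma big_narrow3 (R : Type) (idx : R) (op : Monoid.com_law idx)
    (m : nat) (le_3m : (3 <= m)%N) (f : 'I_m -> R) i j k :
  uniq [:: i; j; k] ->
  \big[op/idx]_(s < m) f s =
  op (op (op (f (widen_ord le_3m i)) (f (widen_ord le_3m j)))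
         (f (widen_ord le_3m k)))
     (\big[op/idx]_(s < m | (3 <= s)%N) f s).
Proof.
move=> u; rewrite (bigID (fun s : 'I_m => (s < 3)%N)) (big_ord_narrow le_3m) /=.
rewrite (big_ord3 _ _ u); congr (op _ _); apply: eq_bigl => s.
by rewrite -leqNgt.
Qed.

(** Indices are modulo 3, so that [k + 1] and [k + 2] are the vertices other
    than [k]; by skew-symmetry their order does not matter. *)
Definition opposite (C : 'M[int]_3) (k : 'I_3) : int := `|C (k + 1) (k + 2%:R)|.

Lemma oppositeE (C : 'M[int]_3) i j k :
  C^T = - C -> uniq [:: i; j; k] -> opposite C k = `|C i j|.
Proof.
move=> sk; have skE a b : `|C a b| = `|C b a|.
  by move/matrixP/(_ b a): sk; rewrite !mxE => ->; rewrite normrN.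
have e1 : (1 + 1 : 'I_3) = 2%:R by apply: val_inj.
have e2 : (1 + 2%:R : 'I_3) = 0 by apply: val_inj.
have e3 : (2%:R + 1 : 'I_3) = 0 by apply: val_inj.
have e4 : (2%:R + 2%:R : 'I_3) = 1 by apply: val_inj.
rewrite /opposite => u; suff: `|C (k + 1) (k + 2%:R)| = `|C i j| \/
    `|C (k + 1) (k + 2%:R)| = `|C j i| by case=> ->.
case: (ord3_cases i) u => ->; case: (ord3_cases j) => ->;
  case: (ord3_cases k) => -> // _; rewrite ?add0r ?e1 ?e2 ?e3 ?e4; auto.
Qed.

Lemma uniq3E (T : eqType) (i j k : T) :
  uniq [:: i; j; k] = [&& i != j, i != k & j != k].
Proof. by rewrite /= !inE negb_or andbT andbA. Qed.

Lemma uniq3_swap (T : eqType) (i j k : T) :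
  uniq [:: i; j; k] -> uniq [:: j; i; k].
Proof. by rewrite !uniq3E eq_sym => /and3P[-> -> ->]. Qed.

Lemma uniq3_rot (T : eqType) (i j k : T) :
  uniq [:: i; j; k] -> uniq [:: j; k; i].
Proof. by rewrite !uniq3E ![_ == i]eq_sym => /and3P[-> -> ->]. Qed.

Lemma other_two (k : 'I_3) : exists i j, uniq [:: i; j; k].
Proof.
by case: (ord3_cases k) => ->; [exists 1, 2%:R | exists 0, 2%:R | exists 0, 1].
Qed.

Section RankThree.

Variables (F : fieldType) (m : nat) (le_3m : (3 <= m)%N).
Local Notation w := (widen_ord le_3m).
Local Notation pp B := (principal_part le_3m B).
Implicit Types (B : 'M[int]_(m, 3)) (t : seed F m 3) (i j k : 'I_3).

Lemma principal_partE B i j : pp B i j = B (w i) j.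
Proof. by rewrite mxE. Qed.

Lemma opposite_mutate_other B k i : skew_symmetric (pp B) -> i != k ->
  opposite (pp (mutate_mx le_3m B k)) i = opposite (pp B) i.
Proof.
move=> sk ik; have sk' := mutate_mx_skew k sk.
have [j u] : exists j, uniq [:: k; j; i].
  case: (ord3_cases k) ik => ->; case: (ord3_cases i) => -> // _;
  by [exists 0 | exists 1 | exists 2%:R].
rewrite (oppositeE sk u) (oppositeE sk' u) !principal_partE.
by rewrite mutate_mxE eqxx normrN.
Qed.

(** A path through [k] composes to arrows opposite to those of the cycle, and
    these outnumber the old ones because the new quiver is again cyclic. *)
Lemma opposite_mutate B i j k : skew_symmetric (pp B) -> cyclic_mx (pp B) ->
  cyclic_mx (pp (mutate_mx le_3m B k)) -> uniq [:: i; j; k] ->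
  opposite (pp (mutate_mx le_3m B k)) k =
    opposite (pp B) i * opposite (pp B) j - opposite (pp B) k.
Proof.
move=> sk cyc cyc' u; have sk' := mutate_mx_skew k sk.
have ujki := uniq3_rot u; have uikj := uniq3_rot (uniq3_swap u).
rewrite (oppositeE sk' u) (oppositeE sk u).
rewrite (oppositeE sk ujki) (oppositeE sk uikj).
have := cyc' i j k u; have := cyc i j k u; have := cyc j k i ujki.
have /skew_principal_partP skE := sk.
have weq (a b : 'I_3) : (w a == w b) = (a == b) by rewrite -!val_eqE.
have /and3P[ij ik jk] : [&& i != j, i != k & j != k] by rewrite -uniq3E.
rewrite !principal_partE !mutate_mxE !weq.
rewrite (negbTE ik) (negbTE jk) !eqxx ?orbT /=.
rewrite (skE i k) (skE k j) !opprK normrN.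
move: (B (w i) j) (B (w j) k) (B (w k) i) => x y z yz xy new.
have [y0|y0|y0] := ltgtP 0 y; last by rewrite -y0 mulr0 in xy.
  have z0 : 0 < z by rewrite pmulr_rgt0 in yz.
  have x0 : 0 < x by rewrite pmulr_lgt0 in xy.
  move: new; rewrite !(pos_part_eq0 (a := - _)) ?oppr_le0 ?ltW //.
  rewrite !pos_part_id ?ltW // mul0r sub0r (gtr0_norm x0) (gtr0_norm y0).
  rewrite (gtr0_norm z0) mulrN -mulNr pmulr_lgt0 // => new.
  by rewrite ltr0_norm; [ring|rewrite -oppr_gt0].
have z0 : z < 0 by rewrite nmulr_rgt0 in yz.
have x0 : x < 0 by rewrite nmulr_lgt0 in xy.
move: new; rewrite (pos_part_eq0 (ltW y0)) (pos_part_eq0 (ltW z0)).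
rewrite !pos_part_id ?oppr_ge0 ?ltW // mul0r subr0 (ltr0_norm x0).
rewrite (ltr0_norm y0) (ltr0_norm z0) pmulr_lgt0 ?oppr_gt0 // => new.
by rewrite gtr0_norm //; ring.
Qed.

Lemma opposite_gt0 (C : 'M[int]_3) k : cyclic_mx C -> 0 < opposite C k.
Proof.
move=> cyc; rewrite normr_gt0.
have := cyc (k + 1) (k + 2%:R) k.
case: (ord3_cases k) => -> /(_ isT); apply: contraTneq => ->; by rewrite mul0r.
Qed.

(** The vector of multiplicities spans the kernel of the principal part, which
    is why it is a grading for which frozen variables can have degree 0. *)
Definition cluster_degree t (i : 'I_m) : int :=
  if insub (i : nat) is Some k then opposite (pp (seed_mx t)) k else 0.

Lemma cluster_degree_var t k :
  cluster_degree t (w k) = opposite (pp (seed_mx t)) k.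
Proof. by rewrite /cluster_degree -[val (w k)]/(val k) valK. Qed.

Lemma cluster_degree_frozen t (i : 'I_m) : (3 <= i)%N -> cluster_degree t i = 0.
Proof. by move=> le3i; rewrite /cluster_degree insubF // ltnNge le3i. Qed.

Lemma sum_cluster_degree t (c : 'I_m -> int) i j k : uniq [:: i; j; k] ->
  \sum_(s < m) cluster_degree t s * c s =
  opposite (pp (seed_mx t)) i * c (w i) + opposite (pp (seed_mx t)) j * c (w j)
  + opposite (pp (seed_mx t)) k * c (w k).
Proof.
move=> u; rewrite (big_narrow3 _ le_3m _ u) /= !cluster_degree_var.
rewrite [X in _ + X]big1 ?addr0 // => s /cluster_degree_frozen->.
by rewrite mul0r.
Qed.

(** As the orientation is cyclic, one exchange monomial at [k] contains only
    [x_i] and the other only [x_j]; both have as degree the product of the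
    multiplicities attached to [i] and [j]. *)
Lemma cyclic_homogeneous_exchange t k :
  skew_symmetric (pp (seed_mx t)) -> cyclic_mx (pp (seed_mx t)) ->
  cyclic_mx (pp (seed_mx (mutate le_3m t k))) ->
  homogeneous_exchange le_3m cluster_degree t k.
Proof.
move=> sk cyc cyc'; have [i [j u]] := other_two k.
have ujki := uniq3_rot u; have uikj := uniq3_rot (uniq3_swap u).
have kk := skew_diag0 k sk.
have := cyc i k j uikj; rewrite !principal_partE.
have /skew_principal_partP/(_ k j) -> := sk; rewrite mulrN oppr_gt0 => signs.
split.
- move=> i' ik; have [lt_i3|le_3i] := ltnP i' 3; last first.
    by rewrite !cluster_degree_frozen.
  have iE : i' = w (Ordinal lt_i3) by apply: val_inj.
  rewrite iE !cluster_degree_var opposite_mutate_other //.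
- rewrite (sum_cluster_degree _ _ u) !cluster_degree_var.
  rewrite (opposite_mutate sk cyc cyc' u) kk.
  rewrite (oppositeE sk ujki) (oppositeE sk uikj) !principal_partE; move: signs.
  move: (seed_mx t (w i) k) (seed_mx t (w j) k) => x y.
  by rewrite /pos_part; have [x0|x0|->] := ltrgtP x 0; nia.
- rewrite (sum_cluster_degree _ _ u) !cluster_degree_var.
  rewrite (opposite_mutate sk cyc cyc' u) kk.
  rewrite (oppositeE sk ujki) (oppositeE sk uikj) !principal_partE; move: signs.
  move: (seed_mx t (w i) k) (seed_mx t (w j) k) => x y.
  by rewrite /pos_part; have [x0|x0|->] := ltrgtP x 0; nia.
Qed.

Definition frozen_monomial t (f : F) : Prop :=
  exists c : 'I_m -> int, f = \prod_(s < m | (3 <= s)%N) seed_var t s ^ c s.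

Lemma cyclic_exchange t i j k : uniq [:: i; j; k] ->
  seed_var t (w k) != 0 ->
  skew_symmetric (pp (seed_mx t)) -> cyclic_mx (pp (seed_mx t)) ->
  exists u v, [/\ frozen_monomial t u, frozen_monomial t v &
    seed_var t (w k) * seed_var (mutate le_3m t k) (w k) =
    u * seed_var t (w i) ^ opposite (pp (seed_mx t)) j +
    v * seed_var t (w j) ^ opposite (pp (seed_mx t)) i].
Proof.
move=> uijk xk0 sk cyc.
have ujki := uniq3_rot uijk; have uikj := uniq3_rot (uniq3_swap uijk).
have := cyc i k j uikj; rewrite (oppositeE sk ujki) (oppositeE sk uikj).
have /skew_principal_partP skE := sk; rewrite !principal_partE (skE k j).
rewrite exchange_relation // /exchange_sum !(big_narrow3 _ _ _ uijk) /=.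
rewrite (skew_diag0 k sk) oppr0 (_ : pos_part 0 = 0) ?expr0z ?mulr1 //.
rewrite mulrN oppr_gt0 => signs.
pose U c := \prod_(s < m | (3 <= s)%N) seed_var t s ^ c s.
have fU c : frozen_monomial t (U c) by exists c.
have [ik0|ik0|ik0] := ltrgtP (seed_mx t (w i) k) 0.
- have jk0 : 0 < seed_mx t (w j) k by rewrite nmulr_rlt0 in signs.
  exists (U (fun s => pos_part (- seed_mx t s k))).
  exists (U (fun s => pos_part (seed_mx t s k))); split=> //.
  rewrite (pos_part_id (ltW jk0)) (pos_part_eq0 (ltW ik0)).
  rewrite pos_part_id ?oppr_ge0 1?ltW // pos_part_eq0 ?oppr_le0 1?ltW //.
  rewrite (ltr0_norm ik0) (gtr0_norm jk0) !expr0z !mul1r !mulr1 addrC.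
  by congr (_ + _); rewrite mulrC.
- have jk0 : seed_mx t (w j) k < 0 by rewrite pmulr_rlt0 in signs.
  exists (U (fun s => pos_part (seed_mx t s k))).
  exists (U (fun s => pos_part (- seed_mx t s k))); split=> //.
  rewrite (pos_part_id (ltW ik0)) (pos_part_eq0 (ltW jk0)).
  rewrite (pos_part_id (a := - seed_mx t (w j) k)) ?oppr_ge0 1?ltW //.
  rewrite pos_part_eq0 ?oppr_le0 1?ltW //.
  rewrite (gtr0_norm ik0) (ltr0_norm jk0) !expr0z !mul1r !mulr1.
  by congr (_ + _); rewrite mulrC.
- by rewrite ik0 mul0r in signs.
Qed.

End RankThree.

(** * A non-acyclic mutation class *)

(** Read with [a = x1^d2], [b = x1^(d3-d2)], [c = x2^(d1-1)] and
    [d = x3^(d1-1)], this identifies the two expressions of the element that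
    separates the two algebras. *)
Lemma numerator_identity (K : fieldType) (y y' z z' a b c d p q p' q' : K) :
  y != 0 -> z != 0 -> a != 0 ->
  y * y' = p * (a * b) + q * (z * d) -> z * z' = p' * a + q' * (y * c) ->
  (p * p' * (a * b) + p * q' * (b * (y * c)) + q * p' * (z * d)) / (y * z) =
  (y' * z' - q * q' * (c * d)) / a.
Proof.
move=> y0 z0 a0 yE zE.
have -> : y' = (p * (a * b) + q * (z * d)) / y by rewrite -yE mulrC mulKf.
have -> : z' = (p' * a + q' * (y * c)) / z by rewrite -zE mulrC mulKf.
by field; rewrite y0 z0 a0.
Qed.

Section MutationClass.

Variables (m : nat) (le_3m : (3 <= m)%N) (s : seed (ratfun m) m 3).
Hypothesis s_seed : is_seed le_3m s.
Hypothesis s_nonacyclic : ~ acyclic_cluster_algebra le_3m s.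

Local Notation w := (widen_ord le_3m).
Local Notation mut := (mutate le_3m).
Local Notation class := (mutation_equivalent le_3m s).
Local Notation deg := (cluster_degree le_3m).
Local Notation opp t := (opposite (principal_part le_3m (seed_mx t))).
Implicit Types (t : seed (ratfun m) m 3) (i j k l : 'I_3).

Lemma class_refl : class s.
Proof. by exists [::]. Qed.

Lemma class_mutate t k : class t -> class (mut t k).
Proof. by move=> [ks ->]; exists (rcons ks k); rewrite foldl_rcons. Qed.

Lemma class_ind (P : seed (ratfun m) m 3 -> Prop) :
  P s -> (forall t k, class t -> P t -> P (mut t k)) ->
  forall t, class t -> P t.
Proof.
move=> Ps Pm t [ks ->]; elim/last_ind: ks => [//|ks k IH].
by rewrite foldl_rcons; apply: Pm => //; exists ks.
Qed.

Lemma class_skew t : class t ->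
  skew_symmetric (principal_part le_3m (seed_mx t)).
Proof.
by move: t; apply: class_ind => [|t k _ /(mutate_mx_skew k)//]; case: s_seed.
Qed.

Lemma class_independent t : class t -> alg_independent (seed_var t).
Proof.
move: t; apply: class_ind => [|t k /class_skew sk].
  by case: s_seed => -[].
exact: alg_independent_mutate.
Qed.

Lemma class_nonzero t : class t -> nonzero_seed t.
Proof. by move=> /class_independent ind i; apply: alg_independent_neq0. Qed.

Lemma class_cyclic t : class t -> cyclic_mx (principal_part le_3m (seed_mx t)).
Proof.
move=> ct; apply: nonacyclic_cyclic; first exact: class_skew.
by move=> ac; apply: s_nonacyclic; exists t.
Qed.

Lemma class_homogeneous t k : class t -> homogeneous_exchange le_3m deg t k.
Proof.
by move=> ct; apply: cyclic_homogeneous_exchange;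
  [exact: class_skew|apply: class_cyclic..] => //; apply: class_mutate.
Qed.

Lemma class_mutateK t k : class t -> mut (mut t k) k = t.
Proof.
move=> ct; apply: mutateK; first exact: class_skew.
exact/class_nonzero/class_mutate.
Qed.

Lemma class_opposite t i j k : class t -> uniq [:: i; j; k] ->
  opp (mut t k) k = opp t i * opp t j - opp t k.
Proof.
move=> ct; apply: opposite_mutate; first exact: class_skew.
  exact: class_cyclic.
exact: class_cyclic (class_mutate k ct).
Qed.

Lemma class_opposite_other t i k : class t -> i != k ->
  opp (mut t k) i = opp t i.
Proof. by move=> ct; apply: opposite_mutate_other; apply: class_skew. Qed.

Lemma class_opposite_gt0 t k : class t -> 0 < opp t k.
Proof. by move=> ct; apply/opposite_gt0/class_cyclic. Qed.

Lemma class_upper_bound_mutate t k d f : class t ->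
  upper_bound le_3m deg t d f -> upper_bound le_3m deg (mut t k) d f.
Proof.
move=> ct; have cm := class_mutate k ct; apply: upper_bound_mutate.
- exact: class_skew.
- exact: class_nonzero.
- exact: class_nonzero.
- by move=> l; apply: class_homogeneous.
- by move=> l; apply: class_homogeneous.
move=> l lk; have [q u] : exists q, uniq [:: l; k; q].
  case: (ord3_cases l) lk => ->; case: (ord3_cases k) => -> // _;
  by [exists 0 | exists 1 | exists 2%:R].
apply: contraTneq (class_cyclic ct u) => lk0.
by rewrite principal_partE lk0 mul0r.
Qed.

(** Mutation being an involution, the transfer goes from any seed of the class
    back to the initial one, and from there to any other seed. *)
Lemma class_upper_bound t t' d f : class t -> class t' ->
  upper_bound le_3m deg t d f -> upper_bound le_3m deg t' d f.
Proof.
move=> ct ct' Uf; have Us : upper_bound le_3m deg s d f.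
  move: t ct Uf; apply: class_ind => // t k ct IH Uf; apply: IH.
  rewrite -(class_mutateK k ct); apply: class_upper_bound_mutate => //.
  exact: class_mutate.
move: t' ct'; apply: class_ind => // t' k ct' Ut.
exact: class_upper_bound_mutate.
Qed.

Lemma class_frozen t (i : 'I_m) : class t -> (3 <= i)%N ->
  seed_var t i = seed_var s i.
Proof.
move=> ct le3i; move: t ct; apply: class_ind => // t k ct <-.
rewrite mutate_varE; case: eqP => // ik; move: le3i.
by rewrite ik /= leqNgt ltn_ord.
Qed.

Lemma upper_bound_upper_cluster_algebra t d f : class t ->
  upper_bound le_3m deg t d f -> upper_cluster_algebra le_3m s f.
Proof.
move=> ct Uf t' ct'; apply: (@laurent_gen_ring _ _ _ _ deg _ _ d).
  by move=> i; apply: class_frozen.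
apply: (adjacent_ring_laurent (k := 0)); first exact: class_nonzero.
  exact: class_homogeneous.
exact: (class_upper_bound ct).
Qed.

(** * Growth away from a minimal seed *)

Section Root.

Variables (r : seed (ratfun m) m 3) (i j k : 'I_3).
Hypotheses (cr : class r) (u : uniq [:: i; j; k]).
Hypotheses (le_ij : opp r i <= opp r j) (le_jk : opp r j <= opp r k).
Hypothesis le_k : opp r k <= opp r i * opp r j - opp r k.

(* The degree of the mutation of [x_j] at the root. *)
Let D := opp r i * opp r k - opp r j.

Let oi_ge2 : 2 <= opp r i.
Proof.
have := class_opposite_gt0 i cr; have := class_opposite_gt0 j cr.
move: le_ij le_jk le_k; nia.
Qed.

(** Seeds reached from the root by a word without immediate repetition, with
    the last letter of the word. *)
Inductive reduced : seed (ratfun m) m 3 -> 'I_3 -> Prop :=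
| reduced_first l : reduced (mut r l) l
| reduced_next t l l' : reduced t l -> l' != l -> reduced (mut t l') l'.

Lemma reduced_class t l : reduced t l -> class t.
Proof. by elim=> *; apply: class_mutate. Qed.

Lemma class_reduced t : class t -> t = r \/ exists l, reduced t l.
Proof.
pose Q t := t = r \/ exists l, reduced t l.
have Qmut t' l : Q t' -> Q (mut t' l).
  case=> [->|[l' rd]]; first by right; exists l; constructor.
  have [->|ll'] := eqVneq l l'; last first.
    by right; exists l; apply: reduced_next rd _.
  case: rd => [l0|t0 l0 l1 rd _].
    by left; apply: class_mutateK.
  rewrite (class_mutateK _ (reduced_class rd)); right; by exists l0.
have Qs : Q s.
  have [ks rE] := cr; have {rE} : exists ks, s = foldl mut r ks.
    move: r cr; apply: class_ind => [|t1 l ct1 [ks' sE]]; first by exists [::].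
    by exists (l :: ks'); rewrite /= class_mutateK.
  case=> ks' ->; elim/last_ind: ks' => [|ks' l IH]; first by left.
  by rewrite foldl_rcons; apply: Qmut.
by move: t; apply: class_ind => // t l _; apply: Qmut.
Qed.

Let growing t l :=
  [/\ forall q, 2 <= opp t q, forall q, opp t q <= opp t l
    & forall q, q != l -> D <= opp (mut t q) q].

(* With [N] the new largest multiplicity, a further mutation at [q] yields
   [opp t q' * N - opp t q], which is at least [2 N - N = N]. *)
Let growing_mutate t q q' l (N := opp t q * opp t q' - opp t l) :
  class t -> uniq [:: q; q'; l] -> 2 <= opp t q -> 2 <= opp t q' ->
  opp t q <= N -> opp t q' <= N -> D <= opp t q' * N - opp t q ->
  D <= opp t q * N - opp t q' -> growing (mut t l) l.
Proof.
move=> ct uq q2 q'2 qN q'N Dq Dq'; have cm := class_mutate l ct.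
have uq1 := uniq3_rot uq; have uq2 := uniq3_rot (uniq3_swap uq).
have /and3P[_ ql q'l] : [&& q != q', q != l & q' != l] by rewrite -uniq3E.
have oN : opp (mut t l) l = N by apply: class_opposite.
have oq : opp (mut t l) q = opp t q by apply: class_opposite_other.
have oq' : opp (mut t l) q' = opp t q' by apply: class_opposite_other.
split=> p; case: (uniq3_cases uq p) => ->; rewrite ?oN ?oq ?oq' ?lexx ?eqxx //.
- exact: le_trans qN.
- by rewrite (class_opposite cm uq1) oq oq' oN.
- by rewrite (class_opposite cm uq2) oq oq' oN.
Qed.

(** Past the root the last mutated vertex has the largest multiplicity, and
    every mutation that does not go back increases it further. *)
Lemma reduced_growth t l : reduced t l -> growing t l.
Proof.
have ujki := uniq3_rot u; have ukij := uniq3_rot ujki.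
elim=> {t l} [l|t l l' rd [ge2 max_l next_l] l'l].
  case: (uniq3_cases u l) => ->.
  - by apply: (growing_mutate cr ujki);
      move: oi_ge2 le_ij le_jk le_k; rewrite /D; nia.
  - by apply: (growing_mutate cr ukij);
      move: oi_ge2 le_ij le_jk le_k; rewrite /D; nia.
  - by apply: (growing_mutate cr u);
      move: oi_ge2 le_ij le_jk le_k; rewrite /D; nia.
have [q u'] : exists q, uniq [:: l; q; l'].
  case: (ord3_cases l) l'l => ->; case: (ord3_cases l') => -> // _;
  by [exists 0 | exists 1 | exists 2%:R].
have ct := reduced_class rd.
have := next_l l' l'l; rewrite (class_opposite ct u') => DN.
have := ge2 l; have := ge2 q; have := ge2 l'; have := max_l q; have := max_l l'.
move=> h1 h2 h3 h4 h5.
by apply: (growing_mutate ct u') => //; nia.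
Qed.

(** * The cluster algebra inside a ring of Laurent polynomials *)

Let x := seed_var r.
Let ind : alg_independent x := class_independent cr.
Let nz : nonzero_seed r := class_nonzero cr.
Let wt (a : {ffun 'I_m -> int}) : int := \sum_(y < m) deg r y * a y.

Let wtE a : wt a =
  opp r i * a (w i) + opp r j * a (w j) + opp r k * a (w k).
Proof. exact: sum_cluster_degree. Qed.

Let wt0 : wt 0 = 0.
Proof. by rewrite wtE !ffunE !mulr0. Qed.

Let wtD : {morph wt : a b / a + b}.
Proof. by move=> a b; rewrite !wtE !ffunE; ring. Qed.

Let D_gt0 : 0 < D.
Proof. by move: oi_ge2 le_ij le_jk; rewrite /D; nia. Qed.

(** Below degree [D] no negative power of [x_j] is allowed. Nonnegativity of
    the degree is what makes this stable under products: a product of degree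
    less than [D] has both factors of degree less than [D]. *)
Definition low_degree_regular (a : {ffun 'I_m -> int}) : Prop :=
  0 <= wt a /\ (wt a < D -> 0 <= a (w j)).

Local Notation E := low_degree_regular.
Local Notation L := (laurent_support x).

Lemma low_degree_regularD a b : E a -> E b -> E (a + b).
Proof.
move=> [wa aj] [wb bj]; split; rewrite wtD; first exact: addr_ge0.
rewrite ffunE => lt_D; apply: addr_ge0; [apply: aj|apply: bj]; lia.
Qed.

(** A homogeneous Laurent polynomial of degree at least [D] has no monomial on
    which the condition bears. *)
Lemma homogeneous_low_degree_regular d f : D <= d ->
  upper_bound le_3m deg r d f -> L E f.
Proof.
move=> le_d Uf.
have Lf : graded_subring (laurent_gen deg r) d f.
  apply: (adjacent_ring_laurent (k := 0)) (Uf 0) => //.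
  exact: class_homogeneous.
have : L (fun a => wt a = d) f.
  apply: graded_laurent_support Lf => // d' f' [y].
  have wt_delta : wt (delta_vec y) = deg r y.
    rewrite /wt (bigD1 y) //= ffunE eqxx mulr1 big1 ?addr0 // => y' y'y.
    by rewrite ffunE eq_sym (negbTE y'y) mulr0.
  have [Ly LyV] := laurent_monomial_var ind y.
  case=> -[-> ->].
    by apply: laurent_supportS Ly => _ ->.
  apply: laurent_supportS LyV => _ ->; rewrite -wt_delta.
  by apply/eqP; rewrite -addr_eq0 -wtD addNr wt0.
apply: laurent_supportS => a aE; split; first by move: D_gt0; lia.
by rewrite aE ltNge le_d.
Qed.

Let xE y : seed_var r y = x y. Proof. by []. Qed.

Let frozen_exponent f : frozen_monomial r f ->
  exists2 a, laurent_monomial x a f & forall l, a (w l) = 0.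
Proof.
move=> [c ->]; exists [ffun y : 'I_m => if (3 <= y)%N then c y else 0].
  exact: laurent_monomial_prod.
by move=> l; rewrite ffunE /= leqNgt ltn_ord.
Qed.

Let weq l l' : (w l == w l') = (l == l').
Proof. by rewrite -!val_eqE. Qed.

Let ij : i != j. Proof. by move: u; rewrite uniq3E => /and3P[]. Qed.
Let ik : i != k. Proof. by move: u; rewrite uniq3E => /and3P[]. Qed.
Let jk : j != k. Proof. by move: u; rewrite uniq3E => /and3P[]. Qed.

Let coords := (ffunE, ffunMzE, mulrzz, weq, eqxx, negbTE ij, negbTE ik,
  negbTE jk, eq_sym j i, eq_sym k i, eq_sym k j).

Lemma root_var_regular l : L E (x (w l)).
Proof.
have [Ll _] := laurent_monomial_var ind (w l).
apply: laurent_supportS Ll => _ ->; rewrite /E wtE !ffunE !weq.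
have := class_opposite_gt0 i cr; have := class_opposite_gt0 j cr.
have := class_opposite_gt0 k cr.
by split; [nia|case: (_ == _)].
Qed.

Lemma adjacent_var_regular : L E (seed_var (mut r k) (w k)).
Proof.
have [p [q [fp fq eq]]] :=
  cyclic_exchange u (nz (w k)) (class_skew cr) (class_cyclic cr).
have -> : seed_var (mut r k) (w k) =
    p * x (w i) ^ opp r j * (x (w k))^-1
    + q * x (w j) ^ opp r i * (x (w k))^-1.
  by rewrite -mulrDl -eq mulrAC mulfV ?mul1r ?nz.
have [a La a0] := frozen_exponent fp; have [b Lb b0] := frozen_exponent fq.
have var l := laurent_monomial_var ind (w l).
have [L1 _] := laurent_monomialM (laurent_monomialM La
  (laurent_monomialXz (opp r j) (var i))) (laurent_monomialV (var k)).
have [L2 _] := laurent_monomialM (laurent_monomialM Lb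
  (laurent_monomialXz (opp r i) (var j))) (laurent_monomialV (var k)).
have oi := class_opposite_gt0 i cr; have oj := class_opposite_gt0 j cr.
apply: laurent_supportD;
  [apply: laurent_supportS L1|apply: laurent_supportS L2] => _ ->;
   rewrite /E wtE !coords ?a0 ?b0 /=; move: le_k; nia.
Qed.

(** By [reduced_growth] the cluster variables of degree less than [D] are among
    those of the root and the mutation of [x_k]; the latter is regular because
    [x_j] does not occur in its denominator. *)
Lemma class_var_regular t l : class t -> L E (seed_var t (w l)).
Proof.
move=> ct; have : L E (seed_var t (w l)) \/ D <= opp t l; last first.
  case=> // le_D; apply: (homogeneous_low_degree_regular le_D).
  apply: (class_upper_bound ct cr); rewrite -cluster_degree_var.
  by apply: upper_bound_var; apply: class_nonzero.
have [->|[l' rd]] := class_reduced ct; first by left; apply: root_var_regular.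
elim: rd l => {t l' ct} [l' l|t l' l'' rd IH l''l' l].
  have [->|ll'] := eqVneq l l'; last first.
    by left; rewrite mutate_varE weq (negbTE ll'); apply: root_var_regular.
  have ujki := uniq3_rot u; have ukij := uniq3_rot ujki.
  case: (uniq3_cases u l') => ->; last by left; apply: adjacent_var_regular.
    right; rewrite (class_opposite cr ujki).
    by move: oi_ge2 le_ij le_jk le_k; rewrite /D; nia.
  by right; rewrite (class_opposite cr ukij) mulrC.
have [->|ll''] := eqVneq l l''.
  by right; case: (reduced_growth rd) => _ _; apply.
rewrite mutate_varE weq (negbTE ll'').
by rewrite (class_opposite_other (reduced_class rd)).
Qed.

Lemma cluster_algebra_regular f : cluster_algebra le_3m s f -> L E f.
Proof.
have E0 : E 0 by rewrite /E wt0 ffunE; split.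
have L1 : L E 1 := laurent_support1 x E0.
have LM g h : L E g -> L E h -> L E (g * h).
  exact: laurent_supportM low_degree_regularD.
elim=> {f} [f|//|f g _ Lf _ Lg|f g _ Lf _ Lg].
- case=> [|[t ct [l ->]]]; last exact: class_var_regular.
  elim=> {f} [f|//|f g _ Lf _ Lg|f g _ Lf _ Lg].
  + move=> [y le3y]; rewrite -(class_frozen cr le3y) xE.
    have Ey : E (delta_vec y) /\ E (- delta_vec y).
      have yw l : (y == w l) = false.
        by apply: contraTF le3y => /eqP->; rewrite /= -ltnNge ltn_ord.
      by rewrite /E !wtE !ffunE !yw; split; split; rewrite ?mulr0.
    have [Ly LyV] := laurent_monomial_var ind y.
    case=> ->; [apply: laurent_supportS Ly|apply: laurent_supportS LyV];
      by move=> _ ->; case: Ey.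
  + exact: laurent_supportB.
  + exact: LM.
- exact: laurent_supportB.
- exact: LM.
Qed.

(** * An element of the upper cluster algebra outside that ring *)

Lemma frozen_monomial_unit l f : frozen_monomial r f ->
  graded_unit (adjacent_gen le_3m deg r l) 0 f.
Proof.
move=> [c ->].
have -> : 0 = \sum_(y < m | (3 <= y)%N) deg r y * c y.
  by rewrite big1 // => y le3y; rewrite cluster_degree_frozen ?mul0r.
apply: graded_unit_prod => y le3y; apply: adjacent_ring_unit => //.
by apply: contraTneq le3y => ->; rewrite /= -ltnNge ltn_ord.
Qed.

(** The root indices [i], [j], [k] are in order of increasing multiplicity. For
    membership in [adjacent_ring r i] the expression with denominator
    [x_j x_k] is used, and for [j] and [k] the one whose denominator is a power
    of [x_i]. The monomial [T1] has degree [D - opp r k] and exponent -1 in [x_j];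
    it cannot cancel, because it is the only one with exponent -1 in both [x_j]
    and [x_k]. *)
Lemma witness : exists f,
  upper_bound le_3m deg r (D - opp r k) f /\ ~ L E f.
Proof.
have uikj := uniq3_rot (uniq3_swap u).
have sk := class_skew cr; have cyc := class_cyclic cr.
have [p [q [fp fq eqj]]] := cyclic_exchange uikj (nz (w j)) sk cyc.
have [p' [q' [fp' fq' eqk]]] := cyclic_exchange u (nz (w k)) sk cyc.
have [a oiE] : exists a : nat, opp r i = a%:Z + 1.
  by exists `|opp r i - 1|%N; move: oi_ge2; lia.
have [b ojE] : exists b : nat, opp r j = b%:Z.
  by exists `|opp r j|%N; move: oi_ge2 le_ij; lia.
have [c okE] : exists c : nat, opp r k = b%:Z + c%:Z.
  by exists `|opp r k - opp r j|%N; move: le_jk oi_ge2 le_ij; lia.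
have mulnz (z : int) (n : nat) : z *+ n = z * n%:Z by rewrite -mulrzz.
rewrite !xE in eqj eqk.
pose X := x (w i); pose Y := x (w j); pose Z := x (w k).
pose T1 := p * p' * (X ^+ b * X ^+ c) / (Y * Z).
pose T2 := p * q' * (X ^+ c * (Y * Y ^+ a)) / (Y * Z).
pose T3 := q * p' * (Z * Z ^+ a) / (Y * Z).
exists (T1 + T2 + T3); split.
- have wE : T1 + T2 + T3 = (seed_var (mut r j) (w j) * seed_var (mut r k) (w k)
      - q * q' * (Y ^+ a * Z ^+ a)) / X ^+ b.
    rewrite -!mulrDl; apply: numerator_identity.
    + exact: nz.
    + exact: nz.
    + by rewrite expf_neq0 ?nz.
    + by rewrite eqj okE oiE -!PoszD addn1 -exprD -exprS.
    + by rewrite eqk ojE oiE -PoszD addn1 -exprS.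
  move=> l; pose G := adjacent_gen le_3m deg r l.
  have U y : y != w l -> graded_unit G (deg r y) (x y).
    exact: adjacent_ring_unit.
  have V y : graded_subring G (deg r y) (x y) by exact: adjacent_ring_var.
  have FM g (fg : frozen_monomial r g) : graded_subring G 0 g.
    by case: (frozen_monomial_unit l fg).
  have N y : graded_subring G (deg (mut r y) (w y)) (seed_var (mut r y) (w y)).
    by apply: adjacent_ring_exchange => //; apply: class_homogeneous.
  have [li|li] := eqVneq l i; last first.
    have [_ _ Ui] : graded_unit G (opp r i *+ b) (X ^+ b).
      apply: graded_unitX; rewrite -cluster_degree_var; apply: U.
      by rewrite weq eq_sym.
    rewrite wE; apply: gradedM Ui _; first apply: graded_sub.
    + exact: graded_mul (N j) (N k).
    + rewrite !cluster_degree_var.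
      rewrite (class_opposite cr uikj) (class_opposite cr u).
      apply: gradedM (graded_mul (FM _ fq) (FM _ fq'))
        (graded_mul (gradedX a (V (w j))) (gradedX a (V (w k)))) _.
      by rewrite !cluster_degree_var oiE ojE okE !mulnz; ring.
    + rewrite !cluster_degree_var.
      rewrite (class_opposite cr uikj) (class_opposite cr u).
      by rewrite mulnz /D oiE ojE okE; ring.
  have [_ _ Tjk] : graded_unit G (opp r j + opp r k) (Y * Z).
    by rewrite -!cluster_degree_var; apply: graded_unitM; apply: U;
      rewrite weq li eq_sym.
  rewrite -!mulrDl; apply: (gradedM (d := opp r i * opp r k)) Tjk _; last first.
    by rewrite /D; ring.
  have VX n := gradedX n (V (w i)); have VY := V (w j); have VZ := V (w k).
  have VYn n := gradedX n (V (w j)); have VZn n := gradedX n (V (w k)).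
  rewrite !cluster_degree_var in VX VY VZ VYn VZn.
  apply: gradedD; [apply: gradedD|].
  + apply: gradedM (graded_mul (FM _ fp) (FM _ fp'))
      (graded_mul (VX b) (VX c)) _.
    by rewrite oiE okE !mulnz; ring.
  + apply: gradedM (graded_mul (FM _ fp) (FM _ fq'))
      (graded_mul (VX c) (graded_mul VY (VYn a))) _.
    by rewrite oiE ojE okE !mulnz; ring.
  + apply: gradedM (graded_mul (FM _ fq) (FM _ fp'))
      (graded_mul VZ (VZn a)) _.
    by rewrite oiE okE !mulnz; ring.
move=> Lf.
have [ap Lp p0] := frozen_exponent fp; have [aq Lq q0] := frozen_exponent fq.
have [ap' Lp' p'0] := frozen_exponent fp'.
have [aq' Lq' q'0] := frozen_exponent fq'.
have LX n := laurent_monomialX n (laurent_monomial_var ind (w i)).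
have LY := laurent_monomial_var ind (w j).
have LZ := laurent_monomial_var ind (w k).
have LYZ := laurent_monomialV (laurent_monomialM LY LZ).
have L1 := laurent_monomialM (laurent_monomialM (laurent_monomialM Lp Lp')
  (laurent_monomialM (LX b) (LX c))) LYZ.
have [L2 _] := laurent_monomialM (laurent_monomialM
  (laurent_monomialM Lp Lq') (laurent_monomialM (LX c)
    (laurent_monomialM LY (laurent_monomialX a LY)))) LYZ.
have [L3 _] := laurent_monomialM (laurent_monomialM (laurent_monomialM Lq Lp')
  (laurent_monomialM LZ (laurent_monomialX a LZ))) LYZ.
(* [T2] has a nonnegative exponent in [x_j] and [T3] in [x_k]; this weaker
   condition holds for them and still excludes [T1]. *)
pose E' (v : {ffun 'I_m -> int}) := wt v < D -> 0 <= v (w j) \/ 0 <= v (w k).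
have LT1 : L E' T1.
  have -> : T1 = T1 + T2 + T3 - T2 - T3 by rewrite addrAC addrK addrK.
  do 2?apply: laurent_supportB.
  - by apply: laurent_supportS Lf => v [_ vj] /vj; left.
  - apply: laurent_supportS L2 => _ -> _; left.
    by rewrite !(coords, ffunMnE) ?p0 ?q'0 /=; lia.
  - apply: laurent_supportS L3 => _ -> _; right.
    by rewrite !(coords, ffunMnE) ?q0 ?p'0 /=; lia.
have T10 : T1 != 0.
  rewrite /T1 !mulf_neq0 ?invr_eq0 ?mulf_neq0 ?expf_neq0 ?nz //.
    by case: (frozen_monomial_unit i fp).
  by case: (frozen_monomial_unit i fp').
have := laurent_support_monomial ind T10 L1 LT1.
rewrite /E' wtE !(coords, ffunMnE) ?p0 ?p'0 /= /D oiE ojE okE.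
lia.
Qed.

End Root.

(** If the largest multiplicity exceeds half the product of the two others,
    mutating there lowers the total, and the total is nonnegative. *)
Lemma class_root : exists r i j k,
  [/\ class r, uniq [:: i; j; k], opp r i <= opp r j, opp r j <= opp r k
    & opp r k <= opp r i * opp r j - opp r k].
Proof.
suff descend (n : nat) t : class t -> \sum_(l < 3) opp t l < n%:Z ->
    exists r i j k,
    [/\ class r, uniq [:: i; j; k], opp r i <= opp r j, opp r j <= opp r k
      & opp r k <= opp r i * opp r j - opp r k].
  by apply: (descend (absz (\sum_(l < 3) opp s l)).+1 s class_refl); lia.
elim: n t => [|n IHn] t ct lt_n.
  have : 0 <= \sum_(l < 3) opp t l by apply: sumr_ge0.
  by rewrite leNgt lt_n.
have [i [j [k [u ij jk]]]] : exists i j k,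
    [/\ uniq [:: i; j; k], opp t i <= opp t j & opp t j <= opp t k].
  have [h01|/ltW h01] := leP (opp t 0) (opp t 1);
  have [h12|/ltW h12] := leP (opp t 1) (opp t 2%:R);
  have [h02|/ltW h02] := leP (opp t 0) (opp t 2%:R).
  - by exists 0, 1, 2%:R.
  - by exists 0, 1, 2%:R.
  - by exists 0, 2%:R, 1.
  - by exists 2%:R, 0, 1.
  - by exists 1, 0, 2%:R.
  - by exists 1, 2%:R, 0.
  - by exists 2%:R, 1, 0.
  - by exists 2%:R, 1, 0.
have [le_k|gt_k] := leP (opp t k) (opp t i * opp t j - opp t k).
  by exists t, i, j, k.
apply: (IHn (mut t k)); first exact: class_mutate.
move: lt_n; rewrite !(big_ord3 _ _ u) /= (class_opposite ct u).
have /and3P[_ ik jk'] : [&& i != j, i != k & j != k] by rewrite -uniq3E.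
by rewrite !class_opposite_other //; lia.
Qed.

End MutationClass.

Theorem theorem1p3 (m : nat) (le_3m : (3 <= m)%N)
    (s : seed (ratfun m) m 3) (s_seed : is_seed le_3m s)
    (s_nonacyclic : ~ acyclic_cluster_algebra le_3m s) :
  ~ (forall f : ratfun m,
       cluster_algebra le_3m s f <-> upper_cluster_algebra le_3m s f).
Proof.
move=> AU.
have [r [i [j [k [cr u ij jk kk]]]]] := class_root s_seed s_nonacyclic.
have [f [Uf nLf]] := witness s_seed s_nonacyclic cr u ij jk kk.
apply: nLf; apply: (cluster_algebra_regular s_seed s_nonacyclic cr u ij jk kk).
apply/AU; exact: (upper_bound_upper_cluster_algebra s_seed s_nonacyclic cr Uf).
Qed.
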